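(* Let $\mathbb{F}$ be a field, $p\in\mathbb{F}$ a nonzero scalar, $V$ an $\mathbb{F}$-vector space (of finite or infinite dimension) with a linearly ordered basis $\mathbb{B}\subset V$, and let $\tau\colon V\otimes V\to V\otimes V$ be the braiding defined for $a,b\in\mathbb{B}$ by $$\tau(a\otimes b)=\begin{cases}-a\otimes a & \text{if } a=b,\\ -(1-p)\,a\otimes b-b\otimes a & \text{if } a>b,\\ -p\,b\otimes a & \text{if } a<b.\end{cases}$$ Then the exterior algebra $\bigwedge V$ (with its usual product $\nabla$ and unit $\eta$) is a braided Hopf algebra in which all the elements of $V$ are primitive (i.e. $\Delta v=v\otimes 1+1\otimes v$ for all $v\in V$) and whose braiding is induced by $\tau$.
   Context: A braided Hopf algebra over $\mathbb{F}$ is a vector space $H$ with an invertible linear map $\beta\colon H\otimes H\to H\otimes H$ (the braiding) satisfying the Yang--Baxter equation $(\beta\otimes\mathrm{id})(\mathrm{id}\otimes\beta)(\beta\otimes\mathrm{id})=(\mathrm{id}\otimes\beta)(\beta\otimes\mathrm{id})(\mathrm{id}\otimes\beta)$, and linear maps $\nabla\colon H\otimes H\to H$, $\eta\colon\mathbb{F}\to H$, $\Delta\colon H\to H\otimes H$, $\epsilon\colon H\to\mathbb{F}$, $S\colon H\to H$ such that: $(H,\nabla,\eta)$ is an associative unital algebra; $(H,\Delta,\epsilon)$ is a coassociative counital coalgebra; $\nabla(\mathrm{id}\otimes S)\Delta=\eta\epsilon=\nabla(S\otimes\mathrm{id})\Delta$; $\Delta\nabla=(\nabla\otimes\nabla)(\mathrm{id}\otimes\beta\otimes\mathrm{id})(\Delta\otimes\Delta)$;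 and all structure maps are compatible with the braiding, i.e. $\beta(\eta\otimes\mathrm{id})=\mathrm{id}\otimes\eta$, $\beta(\mathrm{id}\otimes\eta)=\eta\otimes\mathrm{id}$, $(\epsilon\otimes\mathrm{id})\beta=\mathrm{id}\otimes\epsilon$, $(\mathrm{id}\otimes\epsilon)\beta=\epsilon\otimes\mathrm{id}$, $\beta(\nabla\otimes\mathrm{id})=(\mathrm{id}\otimes\nabla)(\beta\otimes\mathrm{id})(\mathrm{id}\otimes\beta)$, $\beta(\mathrm{id}\otimes\nabla)=(\nabla\otimes\mathrm{id})(\mathrm{id}\otimes\beta)(\beta\otimes\mathrm{id})$, $(\mathrm{id}\otimes\Delta)\beta=(\beta\otimes\mathrm{id})(\mathrm{id}\otimes\beta)(\Delta\otimes\mathrm{id})$, $(\Delta\otimes\mathrm{id})\beta=(\mathrm{id}\otimes\beta)(\beta\otimes\mathrm{id})(\mathrm{id}\otimes\Delta)$, $\beta(S\otimes\mathrm{id})=(\mathrm{id}\otimes S)\beta$, $\beta(\mathrm{id}\otimes S)=(S\otimes\mathrm{id})\beta$. The map $\tau$ is invertible and satisfies the Yang--Baxter equation on $V^{\otimes 3}$. The braiding $\hat\tau$ of a braided Hopf algebra generated as an algebra by $V$ is said to be induced by $\tau$ if $\hat\tau|_{V\otimes V}=\tau$, $\hat\tau(\eta\otimes\mathrm{id})=\mathrm{id}\otimes\eta$, $\hat\tau(\mathrm{id}\otimes\eta)=\eta\otimes\mathrm{id}$, and the fusion relation $\hat\tau(\nabla\otimes\nabla)=(\nabla\otimes\nabla)(\mathrm{id}\otimes\hat\tau\otimes\mathrm{id})(\hat\tau\otimes\hat\tau)(\mathrm{id}\otimes\hat\tau\otimes\mathrm{id})$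 holds. *)

(* Defs.v *)
From HB Require Import structures.
From mathcomp Require Import all_boot all_order all_algebra.
From mathcomp Require Import finmap boolp.
From mathcomp Require Import monalg.

Set Implicit Arguments.
Unset Strict Implicit.
Unset Printing Implicit Defensive.

Import Order.TTheory GRing.Theory.
Local Open Scope ring_scope.
Local Open Scope quotient_scope.

Section LinearSpan.
Variables (F : fieldType) (M : lmodType F) (S : M -> Prop).

Inductive lspan : M -> Prop :=
| lspan0 : lspan 0
| lspanZD (a : F) (x y : M) of S x & lspan y : lspan (a *: x + y).

Lemma lspan_gen x : S x -> lspan x.
Proof. by move=> Sx; rewrite -[x]addr0 -[x]scale1r; apply: lspanZD lspan0. Qed.

Lemma lspanD x y : lspan x -> lspan y -> lspan (x + y).
Proof.
move=> Sx Sy; elim: Sx => [|a u v Su _ IH]; first by rewrite add0r.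
by rewrite -addrA; apply: lspanZD.
Qed.

Lemma lspanZ a x : lspan x -> lspan (a *: x).
Proof.
elim=> [|c u v Su _ IH]; first by rewrite scaler0; apply: lspan0.
by rewrite scalerDr scalerA; apply: lspanZD.
Qed.

Lemma lspanN x : lspan x -> lspan (- x).
Proof. by rewrite -scaleN1r; apply: lspanZ. Qed.

Lemma lspan_sub (P : M -> Prop) : P 0 ->
  (forall a x y, P x -> P y -> P (a *: x + y)) ->
  (forall x, S x -> P x) -> forall x, lspan x -> P x.
Proof. by move=> P0 PZD SP x; elim=> // a u v Su _ IH; apply: PZD; auto. Qed.

End LinearSpan.

Section QuotientConstruction.
Variables (F : fieldType) (M : lmodType F) (S : M -> Prop).
Local Notation lspan := (lspan S).

Definition lq0_rel : rel M := fun x y => `[< lspan (x - y) >].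

Lemma lq0_rel_equiv : equiv_class_of lq0_rel.
Proof.
split=> [x|x y|y x z].
- by apply/asboolP; rewrite subrr; apply: lspan0.
- by apply/asboolP/asboolP => /(@lspanN _ _ S); rewrite opprB.
- move=> /asboolP xy /asboolP yz; apply/asboolP.
  by rewrite -[x in x - z](subrK y) -addrA; apply: lspanD.
Qed.

Canonical lq0_equiv := EquivRelPack lq0_rel_equiv.

Definition lquot0 := {eq_quot lq0_equiv}.
HB.instance Definition _ := Choice.on lquot0.
HB.instance Definition _ := EqQuotient.on lquot0.

Definition lq0_pi (x : M) : lquot0 := \pi_lquot0 x.

Lemma lq0_piP x y : lq0_pi x = lq0_pi y <-> lspan (x - y).
Proof.
split=> [/eqmodP|] h; first by apply/asboolP.
by apply/eqmodP/asboolP.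
Qed.

Lemma lq0_reprK (x : lquot0) : lq0_pi (repr x) = x.
Proof. exact: reprK. Qed.

Lemma lq0_pi_repr x : lspan (repr (lq0_pi x) - x).
Proof. by apply/lq0_piP; rewrite lq0_reprK. Qed.

Definition lq0_add (x y : lquot0) := lq0_pi (repr x + repr y).
Definition lq0_opp (x : lquot0) := lq0_pi (- repr x).
Definition lq0_scale a (x : lquot0) := lq0_pi (a *: repr x).

Lemma lq0_addE x y : lq0_add (lq0_pi x) (lq0_pi y) = lq0_pi (x + y).
Proof.
by apply/lq0_piP; rewrite opprD addrACA; apply: lspanD; apply: lq0_pi_repr.
Qed.
Lemma lq0_oppE x : lq0_opp (lq0_pi x) = lq0_pi (- x).
Proof. by apply/lq0_piP; rewrite -opprD; apply/(@lspanN _ _ S)/lq0_pi_repr. Qed.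
Lemma lq0_scaleE a x : lq0_scale a (lq0_pi x) = lq0_pi (a *: x).
Proof. by apply/lq0_piP; rewrite -scalerBr; apply/lspanZ/lq0_pi_repr. Qed.

Lemma lq0_ind (P : lquot0 -> Prop) : (forall x, P (lq0_pi x)) -> forall x, P x.
Proof. by move=> h x; rewrite -(lq0_reprK x). Qed.

Lemma lq0_addA : associative lq0_add.
Proof.
by elim/lq0_ind=> x; elim/lq0_ind=> y; elim/lq0_ind=> z; rewrite !lq0_addE addrA.
Qed.
Lemma lq0_addC : commutative lq0_add.
Proof. by elim/lq0_ind=> x; elim/lq0_ind=> y; rewrite !lq0_addE addrC. Qed.
Lemma lq0_add0 : left_id (lq0_pi 0) lq0_add.
Proof. by elim/lq0_ind=> x; rewrite lq0_addE add0r. Qed.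
Lemma lq0_addN : left_inverse (lq0_pi 0) lq0_opp lq0_add.
Proof. by elim/lq0_ind=> x; rewrite lq0_oppE lq0_addE addNr. Qed.

HB.instance Definition _ :=
  GRing.isZmodule.Build lquot0 lq0_addA lq0_addC lq0_add0 lq0_addN.

Lemma lq0_piD x y : lq0_pi (x + y) = lq0_pi x + lq0_pi y.
Proof. by rewrite -lq0_addE. Qed.

Lemma lq0_scaleA a b x : lq0_scale a (lq0_scale b x) = lq0_scale (a * b) x.
Proof. by elim/lq0_ind: x => x; rewrite !lq0_scaleE scalerA. Qed.
Lemma lq0_scale1 : left_id 1 lq0_scale.
Proof. by elim/lq0_ind=> x; rewrite lq0_scaleE scale1r. Qed.
Lemma lq0_scaleDr : right_distributive lq0_scale +%R.
Proof.
move=> a; elim/lq0_ind=> x; elim/lq0_ind=> y.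
by rewrite -lq0_piD !lq0_scaleE -lq0_piD scalerDr.
Qed.
Lemma lq0_scaleDl x : {morph lq0_scale^~ x : a b / a + b}.
Proof.
by move=> a b; elim/lq0_ind: x => x; rewrite /= !lq0_scaleE -lq0_piD scalerDl.
Qed.

HB.instance Definition _ := GRing.Zmodule_isLmodule.Build F lquot0
  lq0_scaleA lq0_scale1 lq0_scaleDr lq0_scaleDl.

Lemma lq0_pi_is_linear : linear lq0_pi.
Proof. by move=> a x y; rewrite lq0_piD; congr (_ + _); rewrite -lq0_scaleE. Qed.
HB.instance Definition _ :=
  GRing.isLinear.Build F M lquot0 *:%R lq0_pi lq0_pi_is_linear.

Lemma lquot_exists : {Q : lmodType F & { pi : {linear M -> Q} |
  (forall x, pi x = 0 <-> lspan x) & (forall q, exists x, pi x = q)}}.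
Proof.
exists (lquot0 : lmodType F); exists (lq0_pi : {linear M -> lquot0}) => [x|q].
  by rewrite -[in lspan x](subr0 x) -(lq0_piP x 0) linear0.
by exists (repr q); apply: lq0_reprK.
Qed.
End QuotientConstruction.

(* M / lspan S; it is opaque, and used only through lq_pi, which is a linear   *)
(* surjection with kernel lspan S.                                            *)
Section Quotient.
Variables (F : fieldType) (M : lmodType F) (S : M -> Prop).

Definition lquot : lmodType F := projT1 (lquot_exists S).
Definition lq_pi : {linear M -> lquot} := s2val (projT2 (lquot_exists S)).

Lemma lq_pi_eq0 x : lq_pi x = 0 <-> lspan S x.
Proof. exact: (s2valP (projT2 (lquot_exists S))). Qed.

Lemma lq_pi_surj q : exists x, lq_pi x = q.
Proof. exact: (s2valP' (projT2 (lquot_exists S))). Qed.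

Lemma lq_piP x y : lq_pi x = lq_pi y <-> lspan S (x - y).
Proof.
rewrite -lq_pi_eq0 linearB; split=> [->|/eqP]; first by rewrite subrr.
by rewrite subr_eq0 => /eqP.
Qed.

Lemma lq_ind (P : lquot -> Prop) : (forall x, P (lq_pi x)) -> forall q, P q.
Proof. by move=> Ppi q; have [x <-] := lq_pi_surj q. Qed.

Section Lift.
Variables (N : lmodType F) (f : {linear M -> N}) (fS : forall x, S x -> f x = 0).

Lemma lq_lift_exists : {g : {linear lquot -> N} | forall x, g (lq_pi x) = f x}.
Proof.
pose g q := f (projT1 (cid (lq_pi_surj q))).
have gE x : g (lq_pi x) = f x.
  rewrite /g; case: cid => y /= /lq_piP Syx.
  apply/eqP; rewrite -subr_eq0 -linearB; apply/eqP.
  elim: Syx => [|a u v Su _ IH]; first by rewrite linear0.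
  by rewrite linearP IH addr0 fS // scaler0.
have g_lin : linear g.
  move=> a; elim/lq_ind=> x; elim/lq_ind=> y.
  by rewrite -linearP !gE linearP.
pose gL := GRing.isLinear.Build F lquot N *:%R g g_lin.
by exists (HB.pack g gL : {linear lquot -> N}).
Qed.

Definition lq_lift : {linear lquot -> N} := sval lq_lift_exists.

Lemma lq_liftE x : lq_lift (lq_pi x) = f x.
Proof. exact: (svalP lq_lift_exists). Qed.
End Lift.
End Quotient.

Section FreeLift.
Variables (F : fieldType) (K : choiceType) (N : lmodType F) (f : K -> N).

Definition free_lift (g : {malg F[K]}) : N := \sum_(k <- msupp g) g@_k *: f k.

Lemma free_liftEw (d : {fset K}) g : (msupp g `<=` d)%fset ->
  free_lift g = \sum_(k <- d) g@_k *: f k.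
Proof.
move=> le; rewrite [LHS](big_fset_incl _ le) => //= x xd /mcoeff_outdom ->.
by rewrite scale0r.
Qed.

Lemma free_lift_is_linear : linear free_lift.
Proof.
move=> a x y; pose d := (msupp x `|` msupp y `|` msupp (a *: x + y))%fset.
have lex : (msupp x `<=` d)%fset by rewrite /d -fsetUA fsubsetUl.
have ley : (msupp y `<=` d)%fset.
  by rewrite /d [(msupp x `|` _)%fset]fsetUC -fsetUA fsubsetUl.
have lez : (msupp (a *: x + y) `<=` d)%fset by rewrite /d fsubsetUr.
rewrite (free_liftEw lex) (free_liftEw ley) (free_liftEw lez).
rewrite scaler_sumr -big_split /=; apply: eq_bigr => k _.
by rewrite mcoeffD mcoeffZ scalerDl scalerA.
Qed.
HB.instance Definition _ :=
  GRing.isLinear.Build F {malg F[K]} N *:%R free_lift free_lift_is_linear.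

Lemma free_liftU k : free_lift << k >> = f k.
Proof. by rewrite (free_liftEw msuppU_le) big_seq_fset1 mcoeffUU scale1r. Qed.
End FreeLift.

Lemma malgUZ (F : fieldType) (K : choiceType) (c : F) (k : K) :
  << c *g k >> = c *: << k >> :> {malg F[K]}.
Proof. by apply/malgP=> k'; rewrite mcoeffZ !mcoeffU mulrnAr mulr1. Qed.

(* The tensor product is the free module on U * W modulo bilinearity; its      *)
(* universal property is tens_lift, tens_liftE and tens_eq.                   *)
Section Tensor.
Variables (F : fieldType) (U W : lmodType F).

Variant tens_rel : {malg F[(U * W)%type]} -> Prop :=
| tens_relDl u u' w : tens_rel (<< (u + u', w) >> - << (u, w) >> - << (u', w) >>)
| tens_relDr u w w' : tens_rel (<< (u, w + w') >> - << (u, w) >> - << (u, w') >>)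
| tens_relZl a u w : tens_rel (<< (a *: u, w) >> - a *: << (u, w) >>)
| tens_relZr a u w : tens_rel (<< (u, a *: w) >> - a *: << (u, w) >>).

Definition tens : lmodType F := lquot tens_rel.

Lemma tensor_exists :
  {t : U -> W -> tens | forall u w, t u w = lq_pi tens_rel << (u, w) >>}.
Proof. by eexists. Qed.

Definition tensor : U -> W -> tens := sval tensor_exists.

Lemma tensorE u w : tensor u w = lq_pi tens_rel << (u, w) >>.
Proof. exact: (svalP tensor_exists). Qed.

Lemma tensorDl u u' w : tensor (u + u') w = tensor u w + tensor u' w.
Proof.
rewrite !tensorE -linearD; apply/lq_piP/lspan_gen.
by rewrite opprD addrA; apply: tens_relDl.
Qed.
Lemma tensorDr u w w' : tensor u (w + w') = tensor u w + tensor u w'.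
Proof.
rewrite !tensorE -linearD; apply/lq_piP/lspan_gen.
by rewrite opprD addrA; apply: tens_relDr.
Qed.
Lemma tensorZl a u w : tensor (a *: u) w = a *: tensor u w.
Proof. by rewrite !tensorE -linearZ; apply/lq_piP/lspan_gen; apply: tens_relZl. Qed.
Lemma tensorZr a u w : tensor u (a *: w) = a *: tensor u w.
Proof. by rewrite !tensorE -linearZ; apply/lq_piP/lspan_gen; apply: tens_relZr. Qed.

Lemma tensor0l w : tensor 0 w = 0.
Proof. by rewrite -(scale0r 0) tensorZl scale0r. Qed.
Lemma tensor0r u : tensor u 0 = 0.
Proof. by rewrite -(scale0r 0) tensorZr scale0r. Qed.

Lemma tensor_linearl w : linear (tensor^~ w).
Proof. by move=> a u u'; rewrite tensorDl tensorZl. Qed.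
Lemma tensor_linearr u : linear (tensor u).
Proof. by move=> a w w'; rewrite tensorDr tensorZr. Qed.
HB.instance Definition _ u :=
  GRing.isLinear.Build F W tens *:%R (tensor u) (tensor_linearr u).

Lemma tens_ind (P : tens -> Prop) : (forall u w, P (tensor u w)) -> P 0 ->
  (forall x y, P x -> P y -> P (x + y)) -> forall x, P x.
Proof.
move=> Pt P0 PD; elim/lq_ind=> g; rewrite [g]monalgE linear_sum /=.
elim/big_ind: _ => // -[u w] _.
by rewrite malgUZ linearZ /= -tensorE -tensorZl.
Qed.

Lemma tens_eq (X : lmodType F) (f g : {linear tens -> X}) :
  (forall u w, f (tensor u w) = g (tensor u w)) -> f =1 g.
Proof.
move=> fg; elim/tens_ind=> //; first by rewrite !linear0.
by move=> x y fgx fgy; rewrite !linearD fgx fgy.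
Qed.

Section Lift.
Variables (X : lmodType F) (f : U -> W -> X).
Hypotheses (fl : forall w, linear (f^~ w)) (fr : forall u, linear (f u)).

Fact tens_lift_subproof x : tens_rel x -> free_lift (fun k => f k.1 k.2) x = 0.
Proof.
have fDl u u' w : f (u + u') w = f u w + f u' w.
  by have := fl w 1 u u'; rewrite !scale1r.
have fDr u w w' : f u (w + w') = f u w + f u w'.
  by have := fr u 1 w w'; rewrite !scale1r.
have f0l w : f 0 w = 0 by apply: (addrI (f 0 w)); rewrite -fDl !addr0.
have f0r u : f u 0 = 0 by apply: (addrI (f u 0)); rewrite -fDr !addr0.
have fZl a u w : f (a *: u) w = a *: f u w.
  by have := fl w a u 0; rewrite f0l !addr0.
have fZr a u w : f u (a *: w) = a *: f u w.
  by have := fr u a w 0; rewrite f0r !addr0.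
case=> *; rewrite !linearB ?linearZ /= !free_liftU /=.
- by rewrite fDl addrAC addrK subrr.
- by rewrite fDr addrAC addrK subrr.
- by rewrite fZl scalerN subrr.
- by rewrite fZr scalerN subrr.
Qed.

Definition tens_lift : {linear tens -> X} := lq_lift tens_lift_subproof.

Lemma tens_liftE u w : tens_lift (tensor u w) = f u w.
Proof. by rewrite tensorE lq_liftE /= free_liftU. Qed.
End Lift.
End Tensor.

Notation "U ⊗ W" := (tens U W)
  (at level 40, left associativity) : type_scope.
Notation "u ⊗ₜ w" := (tensor u w)
  (at level 40, left associativity) : ring_scope.

Section TensorMap.
Variables (F : fieldType) (U U' W W' : lmodType F).
Variables (f : {linear U -> U'}) (g : {linear W -> W'}).

Fact tmap_subproofl w : linear (fun u => f u ⊗ₜ g w).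
Proof. by move=> a u u'; rewrite linearP tensorDl tensorZl. Qed.
Fact tmap_subproofr u : linear (fun w => f u ⊗ₜ g w).
Proof. by move=> a w w'; rewrite linearP tensorDr tensorZr. Qed.

Definition tmap : U ⊗ W -> U' ⊗ W' :=
  tens_lift tmap_subproofl tmap_subproofr.
HB.instance Definition _ := GRing.Linear.on tmap.

Lemma tmapE u w : tmap (u ⊗ₜ w) = f u ⊗ₜ g w.
Proof. exact: tens_liftE. Qed.
End TensorMap.
Arguments tmap : simpl never.

Section TensorAssoc.
Variables (F : fieldType) (U V W : lmodType F).

Fact tassoc_subproof1 w v : linear (fun u : U => u ⊗ₜ ((v : V) ⊗ₜ (w : W))).
Proof. exact: tensor_linearl. Qed.
Fact tassoc_subproof2 w u : linear (fun v : V => (u : U) ⊗ₜ (v ⊗ₜ (w : W))).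
Proof. by move=> a v v'; rewrite tensor_linearl tensor_linearr. Qed.
Definition tassoc_at w : U ⊗ V -> U ⊗ (V ⊗ W) :=
  tens_lift (tassoc_subproof1 w) (tassoc_subproof2 w).
HB.instance Definition _ w := GRing.Linear.on (tassoc_at w).
Lemma tassoc_atE w u v : tassoc_at w (u ⊗ₜ v) = u ⊗ₜ (v ⊗ₜ w).
Proof. exact: tens_liftE. Qed.
Fact tassoc_subproof3 w : linear (tassoc_at w).
Proof. exact: linearP. Qed.
Fact tassoc_subproof4 (x : U ⊗ V) : linear (fun w => tassoc_at w x).
Proof.
move=> a w w'; elim/tens_ind: x => [u v||x y IHx IHy].
- by rewrite !tassoc_atE !tensor_linearr.
- by rewrite !linear0 addr0.
- by rewrite !(linearD (tassoc_at _)) /= IHx IHy scalerDr addrACA.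
Qed.
Definition tassoc : (U ⊗ V) ⊗ W -> U ⊗ (V ⊗ W) :=
  tens_lift tassoc_subproof3 tassoc_subproof4.
HB.instance Definition _ := GRing.Linear.on tassoc.

Lemma tassocE u v w : tassoc (u ⊗ₜ v ⊗ₜ w) = u ⊗ₜ (v ⊗ₜ w).
Proof. by apply: etrans (tassoc_atE _ _ _); apply: tens_liftE. Qed.

Fact tassocV_subproof1 u w : linear (fun v : V => (u : U) ⊗ₜ v ⊗ₜ (w : W)).
Proof. by move=> a v v'; rewrite tensor_linearr tensor_linearl. Qed.
Fact tassocV_subproof2 u v : linear (fun w : W => (u : U) ⊗ₜ (v : V) ⊗ₜ w).
Proof. exact: tensor_linearr. Qed.
Definition tassocV_at u : V ⊗ W -> U ⊗ V ⊗ W :=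
  tens_lift (tassocV_subproof1 u) (tassocV_subproof2 u).
HB.instance Definition _ u := GRing.Linear.on (tassocV_at u).
Lemma tassocV_atE u v w : tassocV_at u (v ⊗ₜ w) = u ⊗ₜ v ⊗ₜ w.
Proof. exact: tens_liftE. Qed.
Fact tassocV_subproof3 u : linear (tassocV_at u).
Proof. exact: linearP. Qed.
Fact tassocV_subproof4 (x : V ⊗ W) : linear (fun u => tassocV_at u x).
Proof.
move=> a u u'; elim/tens_ind: x => [v w||x y IHx IHy].
- by rewrite !tassocV_atE !tensor_linearl.
- by rewrite !linear0 addr0.
- by rewrite !(linearD (tassocV_at _)) /= IHx IHy scalerDr addrACA.
Qed.
Definition tassocV : U ⊗ (V ⊗ W) -> (U ⊗ V) ⊗ W :=
  tens_lift tassocV_subproof4 tassocV_subproof3.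
HB.instance Definition _ := GRing.Linear.on tassocV.

Lemma tassocVE u v w : tassocV (u ⊗ₜ (v ⊗ₜ w)) = u ⊗ₜ v ⊗ₜ w.
Proof. by apply: etrans (tassocV_atE _ _ _); apply: tens_liftE. Qed.

Lemma tassocK : cancel tassoc tassocV.
Proof.
elim/tens_ind=> [x w||x y IHx IHy]; last by rewrite !linearD /= IHx IHy.
  elim/tens_ind: x => [u v||x y IHx IHy]; first by rewrite tassocE tassocVE.
    by rewrite tensor0l !linear0.
  by rewrite tensorDl !linearD /= IHx IHy.
by rewrite !linear0.
Qed.
Lemma tassocVK : cancel tassocV tassoc.
Proof.
elim/tens_ind=> [u x||x y IHx IHy]; last by rewrite !linearD /= IHx IHy.
  elim/tens_ind: x => [v w||x y IHx IHy]; first by rewrite tassocVE tassocE.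
    by rewrite !linear0.
  by rewrite tensorDr !linearD /= IHx IHy.
by rewrite !linear0.
Qed.
End TensorAssoc.
Arguments tassoc {F U V W} : simpl never.
Arguments tassocV {F U V W} : simpl never.

Section TensorUnit.
Variables (F : fieldType) (U : lmodType F).

Fact tlunit_subproofl (u : U) : linear (fun c : F^o => c *: u).
Proof. by move=> a b c; rewrite scalerDl scalerA. Qed.
Fact tlunit_subproofr (c : F^o) : linear (fun u : U => c *: u).
Proof. by move=> a u v; rewrite scalerDr !scalerA mulrC. Qed.
Definition tlunit : F^o ⊗ U -> U :=
  tens_lift tlunit_subproofl tlunit_subproofr.
HB.instance Definition _ := GRing.Linear.on tlunit.
Lemma tlunitE c u : tlunit (c ⊗ₜ u) = c *: u.
Proof. exact: tens_liftE. Qed.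

Definition trunit : U ⊗ F^o -> U :=
  tens_lift tlunit_subproofr tlunit_subproofl.
HB.instance Definition _ := GRing.Linear.on trunit.
Lemma trunitE u c : trunit (u ⊗ₜ c) = c *: u.
Proof. exact: tens_liftE. Qed.
End TensorUnit.
Arguments tlunit {F U} : simpl never.
Arguments trunit {F U} : simpl never.

Lemma malg_scalerAr (F : fieldType) (K : monomType) (c : F) (x y : {malg F[K]}) :
  c *: (x * y) = x * (c *: y).
Proof.
apply/malgP=> k; rewrite mcoeffZ mcoeffMl mulr_sumr.
rewrite (mcoeffMlw k (fsubset_refl _) (msuppZ_le c y)).
apply: eq_bigr => k1 _; rewrite mulr_sumr; apply: eq_bigr => k2 _.
by rewrite mcoeffZ mulrnAr mulrCA.
Qed.

(* {malg F[{fmonom V}]} is the free unital algebra on the set V. The relations *)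
(* ext_relD and ext_relZ turn it into the tensor algebra of V, and ext_sqr     *)
(* turns that into the exterior algebra.                                      *)
Section ExteriorConstruction.
Variables (F : fieldType) (V : lmodType F).

Local Notation freeAlg := {malg F[{fmonom V}]}.
Local Notation gen v := (<< fmu v >> : freeAlg).

Variant ext_rel : freeAlg -> Prop :=
| ext_relD v w : ext_rel (gen (v + w) - gen v - gen w)
| ext_relZ a v : ext_rel (gen (a *: v) - a *: gen v)
| ext_sqr v : ext_rel (gen v * gen v).

Definition ext_ideal : freeAlg -> Prop :=
  lspan (fun z => exists x r y, ext_rel r /\ z = x * r * y).

Lemma ext_idealMl x z : ext_ideal z -> ext_ideal (x * z).
Proof.
elim=> [|a u v [x' [r [y [rr ->]]]] _ IH].
  by rewrite mulr0; apply: lspan0.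
rewrite mulrDr -malg_scalerAr !mulrA; apply: lspanZD => //.
by exists (x * x'), r, y.
Qed.

Lemma ext_idealMr x z : ext_ideal z -> ext_ideal (z * x).
Proof.
elim=> [|a u v [x' [r [y [rr ->]]]] _ IH].
  by rewrite mul0r; apply: lspan0.
rewrite mulrDl -fgscaleAl -!mulrA; apply: lspanZD => //.
by exists x', r, (y * x); rewrite !mulrA.
Qed.

Lemma ext_ideal_const z : ext_ideal z -> z@_mone = 0.
Proof.
have gen0 v : (gen v)@_mone = 0.
  rewrite mcoeffU1; case: eqP => // /(congr1 (@fdeg V)).
  by rewrite fdegU fdeg1.
elim=> [|a u v [x [r [y [rr ->]]]] _ IH]; first by rewrite mcoeff0.
rewrite mcoeffD mcoeffZ IH addr0 !rmorphM /=.
suff -> : r@_mone = 0 by rewrite mulr0 mul0r mulr0.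
case: rr => [v1 w1|b v1|v1].
- by rewrite !mcoeffB !gen0 !subr0.
- by rewrite mcoeffB mcoeffZ !gen0 mulr0 subr0.
- by rewrite rmorphM /= gen0 mul0r.
Qed.

Definition ext0 : Type := lquot (fun z => exists x r y, ext_rel r /\ z = x * r * y).
HB.instance Definition _ := GRing.Lmodule.on ext0.
Definition ext0_pi : freeAlg -> ext0 := lq_pi _.
HB.instance Definition _ := GRing.Linear.on ext0_pi.

Lemma ext0_piP x y : ext0_pi x = ext0_pi y <-> ext_ideal (x - y).
Proof. exact: lq_piP. Qed.

Definition ext0_repr (q : ext0) : freeAlg := projT1 (cid (lq_pi_surj q)).
Lemma ext0_reprK q : ext0_pi (ext0_repr q) = q.
Proof. exact: (projT2 (cid (lq_pi_surj q))). Qed.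
Lemma ext0_ind (P : ext0 -> Prop) : (forall x, P (ext0_pi x)) -> forall q, P q.
Proof. by move=> h q; rewrite -(ext0_reprK q). Qed.

Definition ext0_mul (p q : ext0) := ext0_pi (ext0_repr p * ext0_repr q).
Lemma ext0_mulE x y : ext0_mul (ext0_pi x) (ext0_pi y) = ext0_pi (x * y).
Proof.
have reprP z : ext_ideal (ext0_repr (ext0_pi z) - z).
  by apply/ext0_piP; rewrite ext0_reprK.
apply/ext0_piP; set x' := ext0_repr _; set y' := ext0_repr _.
have -> : x' * y' - x * y = (x' - x) * y' + x * (y' - y).
  by rewrite mulrBl mulrBr addrA subrK.
by apply: lspanD; [apply/ext_idealMr/reprP | apply/ext_idealMl/reprP].
Qed.

Fact ext0_mulA : associative ext0_mul.
Proof.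
by elim/ext0_ind=> x; elim/ext0_ind=> y; elim/ext0_ind=> z;
  rewrite !ext0_mulE mulrA.
Qed.
Fact ext0_mul1 : left_id (ext0_pi 1) ext0_mul.
Proof. by elim/ext0_ind=> x; rewrite ext0_mulE mul1r. Qed.
Fact ext0_mulr1 : right_id (ext0_pi 1) ext0_mul.
Proof. by elim/ext0_ind=> x; rewrite ext0_mulE mulr1. Qed.
Fact ext0_mulDl : left_distributive ext0_mul +%R.
Proof.
elim/ext0_ind=> x; elim/ext0_ind=> y; elim/ext0_ind=> z.
by rewrite -linearD !ext0_mulE -linearD mulrDl.
Qed.
Fact ext0_mulDr : right_distributive ext0_mul +%R.
Proof.
elim/ext0_ind=> x; elim/ext0_ind=> y; elim/ext0_ind=> z.
by rewrite -linearD !ext0_mulE -linearD mulrDr.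
Qed.
Fact ext0_oner_neq0 : ext0_pi 1 != 0.
Proof.
apply/eqP; rewrite -[RHS](linear0 ext0_pi) => /ext0_piP.
rewrite subr0 => /ext_ideal_const.
by rewrite mcoeff1 eqxx => /eqP; rewrite oner_eq0.
Qed.

Fact ext0_piZ a x : ext0_pi (a *: x) = a *: ext0_pi x.
Proof. exact: linearZ. Qed.
Fact ext0_scalerAl a x y : a *: ext0_mul x y = ext0_mul (a *: x) y.
Proof.
elim/ext0_ind: x => x; elim/ext0_ind: y => y.
by rewrite ext0_mulE -!ext0_piZ ext0_mulE scalerAl.
Qed.
Fact ext0_scalerAr a x y : a *: ext0_mul x y = ext0_mul x (a *: y).
Proof.
elim/ext0_ind: x => x; elim/ext0_ind: y => y.
by rewrite ext0_mulE -!ext0_piZ ext0_mulE malg_scalerAr.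
Qed.

HB.instance Definition _ := GRing.Zmodule_isNzRing.Build ext0
  ext0_mulA ext0_mul1 ext0_mulr1 ext0_mulDl ext0_mulDr ext0_oner_neq0.
HB.instance Definition _ :=
  GRing.Lmodule_isLalgebra.Build F ext0 ext0_scalerAl.
HB.instance Definition _ :=
  GRing.Lalgebra_isAlgebra.Build F ext0 ext0_scalerAr.

Lemma ext_exists : {E : algType F & { pi : {linear freeAlg -> E} |
  (forall x, pi x = 0 <-> ext_ideal x) /\ (forall q, exists x, pi x = q) &
  pi 1 = 1 /\ (forall x y, pi (x * y) = pi x * pi y)}}.
Proof.
exists (ext0 : algType F); exists (ext0_pi : {linear freeAlg -> ext0}).
  split=> [x|q]; last exact: lq_pi_surj.
  exact: lq_pi_eq0.
split; first exact: erefl.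
by move=> x y; exact: (esym (ext0_mulE x y)).
Qed.
End ExteriorConstruction.

Section Exterior.
Variables (F : fieldType) (V : lmodType F).

Local Notation freeAlg := {malg F[{fmonom V}]}.

Definition ext : algType F := projT1 (ext_exists V).
Definition ext_pi : {linear freeAlg -> ext} := s2val (projT2 (ext_exists V)).

Lemma ext_pi_eq0 x : ext_pi x = 0 <-> ext_ideal x.
Proof. exact: (s2valP (projT2 (ext_exists V))).1. Qed.
Lemma ext_pi_surj q : exists x, ext_pi x = q.
Proof. exact: (s2valP (projT2 (ext_exists V))).2. Qed.
Lemma ext_pi1 : ext_pi 1 = 1.
Proof. exact: (s2valP' (projT2 (ext_exists V))).1. Qed.
Lemma ext_piM x y : ext_pi (x * y) = ext_pi x * ext_pi y.
Proof. exact: (s2valP' (projT2 (ext_exists V))).2. Qed.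

Lemma ext_incl_exists : {i : V -> ext | forall v, i v = ext_pi << fmu v >>}.
Proof. by eexists. Qed.

Definition ext_incl : V -> ext := sval ext_incl_exists.

Lemma ext_inclE v : ext_incl v = ext_pi << fmu v >>.
Proof. exact: (svalP ext_incl_exists). Qed.

Lemma ext_incl_is_linear : linear ext_incl.
Proof.
have gen r : ext_rel r -> ext_pi r = 0.
  move=> rr; apply/ext_pi_eq0/lspan_gen.
  by exists 1, r, 1; rewrite mulr1 mul1r.
move=> a v w; rewrite !ext_inclE.
have /eqP := gen _ (ext_relD (a *: v) w).
rewrite -addrA -opprD linearB subr_eq0 linearD => /eqP ->; congr (_ + _).
have /eqP := gen _ (ext_relZ a v).
by rewrite linearB subr_eq0 linearZ => /eqP.
Qed.
HB.instance Definition _ :=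
  GRing.isLinear.Build F V ext *:%R ext_incl ext_incl_is_linear.

Lemma ext_incl_sqr v : ext_incl v * ext_incl v = 0.
Proof.
rewrite ext_inclE -ext_piM; apply/ext_pi_eq0/lspan_gen.
exists 1, (<< fmu v >> * << fmu v >>), 1; split; first exact: ext_sqr.
by rewrite mulr1 mul1r.
Qed.
End Exterior.

Section BraidedHopf.
Variables (F : fieldType).

(* Triple tensor products are bracketed to the left, so that f ⊗ id is        *)
(* tmap f idfun and id ⊗ f is idtens f; midtens f is id ⊗ f ⊗ id.             *)
Definition idtens (X Y Z Y' Z' : lmodType F) (f : {linear Y ⊗ Z -> Y' ⊗ Z'}) :
    (X ⊗ Y) ⊗ Z -> (X ⊗ Y') ⊗ Z' :=
  tassocV \o tmap idfun f \o tassoc.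

Definition midtens (X Y Z : lmodType F) (f : {linear Y ⊗ Y -> Y ⊗ Y}) :
    (X ⊗ Y) ⊗ (Y ⊗ Z) -> (X ⊗ Y) ⊗ (Y ⊗ Z) :=
  tassocV \o tmap idfun (tassoc \o tmap f idfun \o tassocV) \o tassoc.

Definition is_braiding (U : lmodType F) (f : {linear U ⊗ U -> U ⊗ U}) : Prop :=
  bijective f /\
  tmap f idfun \o idtens f \o tmap f idfun
    =1 idtens f \o tmap f idfun \o idtens f :> (U ⊗ U ⊗ U -> U ⊗ U ⊗ U).

(* The identifications F ⊗ H = H = H ⊗ F are made by tlunit and trunit.       *)
Record braidedHopf (H : lmodType F) := BraidedHopf {
  hbraid : {linear H ⊗ H -> H ⊗ H};
  hmul : {linear H ⊗ H -> H};
  hunit : {linear F^o -> H};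
  hcomul : {linear H -> H ⊗ H};
  hcounit : {linear H -> F^o};
  hantipode : {linear H -> H};
  hbraidP : is_braiding hbraid;
  hmulA : hmul \o tmap hmul idfun =1 hmul \o tmap idfun hmul \o tassoc;
  hmul1l : hmul \o tmap hunit idfun =1 tlunit;
  hmul1r : hmul \o tmap idfun hunit =1 trunit;
  hcomulA : tassoc \o tmap hcomul idfun \o hcomul =1 tmap idfun hcomul \o hcomul;
  hcomul1l : tlunit \o tmap hcounit idfun \o hcomul =1 idfun;
  hcomul1r : trunit \o tmap idfun hcounit \o hcomul =1 idfun;
  hantipoder : hmul \o tmap idfun hantipode \o hcomul =1 hunit \o hcounit;
  hantipodel : hmul \o tmap hantipode idfun \o hcomul =1 hunit \o hcounit;
  hcomul_mul : hcomul \o hmul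
    =1 tmap hmul hmul \o midtens hbraid \o tmap hcomul hcomul;
  hbraid_unitl c x : hbraid (hunit c ⊗ₜ x) = x ⊗ₜ hunit c;
  hbraid_unitr c x : hbraid (x ⊗ₜ hunit c) = hunit c ⊗ₜ x;
  hbraid_counitl : tlunit \o tmap hcounit idfun \o hbraid
    =1 trunit \o tmap idfun hcounit;
  hbraid_counitr : trunit \o tmap idfun hcounit \o hbraid
    =1 tlunit \o tmap hcounit idfun;
  hbraid_mull : hbraid \o tmap hmul idfun
    =1 tmap idfun hmul \o tassoc \o tmap hbraid idfun \o idtens hbraid;
  hbraid_mulr : hbraid \o tmap idfun hmul \o tassoc
    =1 tmap hmul idfun \o idtens hbraid \o tmap hbraid idfun;
  hbraid_comulr : tassocV \o tmap idfun hcomul \o hbraid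
    =1 tmap hbraid idfun \o idtens hbraid \o tmap hcomul idfun;
  hbraid_comull : tmap hcomul idfun \o hbraid
    =1 idtens hbraid \o tmap hbraid idfun \o tassocV \o tmap idfun hcomul;
  hbraid_antipodel : hbraid \o tmap hantipode idfun
    =1 tmap idfun hantipode \o hbraid;
  hbraid_antipoder : hbraid \o tmap idfun hantipode
    =1 tmap hantipode idfun \o hbraid
}.

Definition generated_by (H V : lmodType F) (B : braidedHopf H)
    (incl : {linear V -> H}) : Prop :=
  forall P : H -> Prop, P (hunit B 1) -> (forall v, P (incl v)) ->
  (forall a x y, P x -> P y -> P (a *: x + y)) ->
  (forall x y, P x -> P y -> P (hmul B (x ⊗ₜ y))) ->
  forall x, P x.

(* The first two clauses (tau is a braiding, V embeds in H and generates it)  *)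
(* are presuppositions of the notion; the others are its defining conditions. *)
Definition induced_by (H V : lmodType F) (B : braidedHopf H)
    (incl : {linear V -> H}) (tau : {linear V ⊗ V -> V ⊗ V}) : Prop :=
  [/\ is_braiding tau,
      injective incl /\ generated_by B incl,
      hbraid B \o tmap incl incl =1 tmap incl incl \o tau,
      (forall c x, hbraid B (hunit B c ⊗ₜ x) = x ⊗ₜ hunit B c) /\
      (forall c x, hbraid B (x ⊗ₜ hunit B c) = hunit B c ⊗ₜ x)
    & hbraid B \o tmap (hmul B) (hmul B)
        =1 tmap (hmul B) (hmul B) \o midtens (hbraid B)
           \o tmap (hbraid B) (hbraid B) \o midtens (hbraid B)].

Definition is_basis (V : lmodType F) (I : eqType) (b : I -> V) : Prop :=
  (forall (s : seq I) (c : I -> F), uniq s ->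
     \sum_(i <- s) c i *: b i = 0 -> {in s, forall i, c i = 0}) /\
  (forall v, lspan (fun x => exists i, x = b i) v).
End BraidedHopf.

(* Main.v *)
(* Write E for the exterior algebra of V. Everything is produced by recursion
   on products of vectors: a linear A : V ⊗ M -> M with A (v ⊗ A (v ⊗ m)) = 0
   extends to an action of E on M. Moving a vector past E and then applying A
   is such an action on E ⊗ M, and so is its sum with left multiplication on E;
   they yield the braiding of E and its coproduct. The square-zero conditions
   hold because tau satisfies the Yang-Baxter equation and the squares v ⊗ v
   span the kernel of tau + 1. Two linear maps on E ⊗ M that obey the same
   recursion coincide, so that each axiom reduces to how the operators involved
   commute with the insertion of one vector. On V ⊗ V the product of E satisfies
   mul tau = p mul, which makes the antipode the scalar (-1)^n p^(n choose 2)
   in degree n. Finally tau satisfies the Hecke relation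
   (tau + 1)(tau - p) = 0, so that its inverse is a braiding of the same kind
   and induces the inverse of the braiding of E. *)
Require Import Defs.
From HB Require Import structures.
From mathcomp Require Import all_boot all_order all_algebra.
From mathcomp Require Import finmap boolp monalg ring.

Set Implicit Arguments.
Unset Strict Implicit.
Unset Printing Implicit Defensive.

Import Order.TTheory GRing.Theory.
Local Open Scope ring_scope.

(** * Actions of the exterior algebra *)

(** The obstacle is that [E] is a quotient: an operator on it exists only once [v * v = 0] has been
    checked, and each operator is then iterated. One computation serves these checks. A map [C] that
    vanishes on the squares [v ⊗ v] factors through [tau + 1]; by the Yang-Baxter equation, carrying
    [v ⊗ v] past an element commutes with [tau]; so [C] after the passage only sees
    [(tau + 1) (v ⊗ v) = 0].

    Most operators carry an arbitrary trailing factor [M]. An induction that strips a vector from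
    the right end of [x] moves it into [M], so its hypothesis must hold for all [M]. The same
    freedom allows [push (push A)], which moves a vector past several factors. *)

Section ExteriorUniversal.
Variables (F : fieldType) (V : lmodType F).
Local Notation E := (ext V : lmodType F).
Local Notation oneE := (1 : ext V).

(** [ext_inc] is [ext_incl] behind an opaque proof, so that simplification does not unfold it. *)
Lemma ext_inc_exists : {f : {linear V -> E} | f =1 @ext_incl F V}.
Proof. by exists (@ext_incl F V). Qed.
Definition ext_inc : {linear V -> E} := sval ext_inc_exists.
Lemma ext_incE v : ext_inc v = ext_incl v.
Proof. exact: (svalP ext_inc_exists). Qed.
Lemma ext_inc_sqr v : ext_inc v * ext_inc v = 0.
Proof. by rewrite ext_incE ext_incl_sqr. Qed.
Local Notation i := ext_inc.

Lemma malgMUU (k k' : {fmonom V}) :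
  << k >> * << k' >> = << mmul k k' >> :> {malg F[{fmonom V}]}.
Proof. by rewrite [LHS]fgmulUU mulr1. Qed.

Lemma malg_linMl (a : F) (x y z : {malg F[{fmonom V}]}) :
  (a *: x + y) * z = a *: (x * z) + y * z.
Proof. by rewrite mulrDl -fgscaleAl. Qed.

Lemma malg_linMr (a : F) (x y z : {malg F[{fmonom V}]}) :
  z * (a *: x + y) = a *: (z * x) + z * y.
Proof. by rewrite mulrDr -malg_scalerAr. Qed.

Lemma malg_ind (K : choiceType) (P : {malg F[K]} -> Prop) :
  P 0 -> (forall a x y, P x -> P y -> P (a *: x + y)) ->
  (forall k, P << k >>) -> forall x, P x.
Proof.
move=> P0 PZD Pk x; rewrite [x]monalgE; elim: (enum_fset _) => [|k s IH].
  by rewrite big_nil.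
by rewrite big_cons malgUZ; apply: PZD.
Qed.

Lemma free_liftP (K : choiceType) (N : lmodType F) (f : K -> N) a x y :
  free_lift f (a *: x + y) = a *: free_lift f x + free_lift f y.
Proof. exact: linearP. Qed.

Lemma ext_pi_word (k : {fmonom V}) : ext_pi V << k >> = \prod_(v <- k) i v.
Proof.
case: k => s; elim: s => [|v s IH].
  by rewrite big_nil -ext_pi1; congr (ext_pi V << _ >>); apply/eqP; rewrite fmP fm1.
have -> : FMonom (v :: s) = mmul (fmu v) (FMonom s).
  by apply/eqP; rewrite fmP fmM fmU.
by rewrite -malgMUU ext_piM IH -ext_inclE -ext_incE fmM fmU big_cons.
Qed.

Lemma ext_ind_word (P : E -> Prop) :
  (forall a x y, P x -> P y -> P (a *: x + y)) ->
  (forall s : seq V, P (\prod_(v <- s) i v)) -> forall x, P x.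
Proof.
move=> PZD Pw x; have [g <-] := ext_pi_surj x.
elim/malg_ind: g => [|a y z Py Pz|k].
- rewrite linear0; have := PZD (-1) 1 1; rewrite scaleN1r addNr; apply;
    by have := Pw [::]; rewrite big_nil.
- by rewrite linearP; apply: PZD.
- by rewrite ext_pi_word; apply: Pw.
Qed.

Lemma ext_ind_l (P : E -> Prop) : P 1 ->
  (forall a x y, P x -> P y -> P (a *: x + y)) ->
  (forall v x, P x -> P (i v * x)) -> forall x, P x.
Proof.
move=> P1 PZD Pl; apply: ext_ind_word => //.
by elim=> [|v s IH]; rewrite (big_nil, big_cons) //; apply: Pl.
Qed.

Lemma ext_ind_r (P : E -> Prop) : P 1 ->
  (forall a x y, P x -> P y -> P (a *: x + y)) ->
  (forall x v, P x -> P (x * i v)) -> forall x, P x.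
Proof.
move=> P1 PZD Pl; apply: ext_ind_word => //.
elim/last_ind=> [|s v IH]; first by rewrite big_nil.
by rewrite big_rcons /= ; apply: Pl.
Qed.

Section Action.
Variables (M : lmodType F) (act : {linear V ⊗ M -> M}).
Hypothesis act_sqr : forall v m, act (v ⊗ₜ act (v ⊗ₜ m)) = 0.

(** The head of the word acts last, so that concatenation of words is composition of actions. *)
Let word m (k : {fmonom V}) : M := foldr (fun v m => act (v ⊗ₜ m)) m k.

Fact word_linear k : linear (word^~ k).
Proof.
move=> a x y; rewrite /word; elim: {k}(k : seq V) => //= v s ->.
by rewrite tensor_linearr linearP.
Qed.

Fact word_lift_linear g : linear (fun m => free_lift (word m) g).
Proof.
move=> a x y; rewrite /free_lift scaler_sumr -big_split /=; apply: eq_bigr => k _.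
by rewrite word_linear scalerDr !scalerA mulrC.
Qed.

Fact word_liftM m x y :
  free_lift (word m) (x * y) = free_lift (word (free_lift (word m) y)) x.
Proof.
elim/malg_ind: x => [|a x z IHx IHz|k]; first by rewrite mul0r !linear0.
  by rewrite [in RHS]free_liftP malg_linMl free_liftP; congr (_ *: _ + _).
elim/malg_ind: y => [|a x z IHx IHz|k'].
- have := word_linear k (-1) 0 0; rewrite /= scaler0 addr0 scaleN1r addNr => w0.
  by rewrite mulr0 !linear0 free_liftU w0.
- rewrite [in RHS]free_liftP malg_linMr free_liftP free_liftU word_linear.
  by rewrite -!(free_liftU (word _)); congr (_ *: _ + _).
- by rewrite malgMUU !free_liftU /word fmM foldr_cat.
Qed.

(** By multiplicativity only the generators of the ideal matter: the two linear relations act by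
    zero because [act] is linear in the vector, the squares by [act_sqr]. *)
Fact word_lift_ideal m z : ext_ideal z -> free_lift (word m) z = 0.
Proof.
have word0 x : free_lift (word 0) x = 0.
  have := word_lift_linear x (-1) 0 0; rewrite scaler0 addr0 => ->.
  by rewrite scaleN1r addNr.
have wordU v n : free_lift (word n) << fmu v >> = act (v ⊗ₜ n).
  by rewrite free_liftU /word fmU.
elim=> [|a u z' [x [r [y [rr ->]]]] _ IH]; first by rewrite linear0.
rewrite linearP /= IH addr0 !word_liftM.
suff -> n : free_lift (word n) r = 0 by rewrite word0 scaler0.
case: rr => [v w|b v|v]; rewrite ?word_liftM ?linearB ?linearZ /= !wordU.
- by rewrite tensorDl linearD /= addrAC addrK subrr.
- by rewrite tensorZl linearZ /= scalerN subrr.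
- exact: act_sqr.
Qed.

Lemma ext_act_exists : {A : {linear E ⊗ M -> M} |
  (forall m, A (oneE ⊗ₜ m) = m) &
  (forall v x m, A ((i v * x) ⊗ₜ m) = act (v ⊗ₜ A (x ⊗ₜ m)))}.
Proof.
(* The value is computed on a chosen representative of [x]; [fE] shows that the choice is
   immaterial. *)
pose f x m := free_lift (word m) (projT1 (cid (ext_pi_surj x))).
have fE g m : f (ext_pi V g) m = free_lift (word m) g.
  rewrite /f; case: cid => y /= /eqP; rewrite -subr_eq0 -linearB => /eqP.
  by move=> /ext_pi_eq0/(word_lift_ideal m)/eqP; rewrite linearB subr_eq0 => /eqP.
have fl m : linear (f^~ m).
  move=> a x y; have [g <-] := ext_pi_surj x; have [h <-] := ext_pi_surj y.
  by rewrite -linearP !fE linearP.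
have fr x : linear (f x) by exact: word_lift_linear.
exists (tens_lift fl fr) => [m|v x m]; rewrite !tens_liftE.
  by rewrite -ext_pi1 fE free_liftU /word fm1.
have [g <-] := ext_pi_surj x.
by rewrite ext_incE ext_inclE -ext_piM !fE word_liftM free_liftU /word fmU.
Qed.

Definition ext_act : {linear E ⊗ M -> M} := s2val ext_act_exists.
Lemma ext_act1 m : ext_act (oneE ⊗ₜ m) = m.
Proof. exact: (s2valP ext_act_exists). Qed.
Lemma ext_actM v x m : ext_act ((i v * x) ⊗ₜ m) = act (v ⊗ₜ ext_act (x ⊗ₜ m)).
Proof. exact: (s2valP' ext_act_exists). Qed.
End Action.

(** * The embedding of V in degree one *)

Section Degree1.
Local Notation freeAlg := {malg F[{fmonom V}]}.

Let deg1 (k : {fmonom V}) : V := if k : seq V is [:: v] then v else 0.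

(** Taking the linear part is a derivation over the constant-term character. *)
Fact free_deg1M (x y : freeAlg) :
  free_lift deg1 (x * y)
    = x@_mone *: free_lift deg1 y + y@_mone *: free_lift deg1 x.
Proof.
elim/malg_ind: x => [|a x x' IHx IHx'|k].
- by rewrite mul0r !linear0 ?mcoeff0 ?scale0r ?scaler0 ?addr0.
- rewrite [in RHS]free_liftP malg_linMl free_liftP mcoeffD mcoeffZ.
  apply: (etrans (congr2 (fun u w => a *: u + w) IHx IHx')).
  by rewrite scalerDl !scalerDr !scalerA addrACA (mulrC a y@__).
elim/malg_ind: y => [|a x x' IHx IHx'|k'].
- by rewrite mulr0 !linear0 ?mcoeff0 ?scale0r ?scaler0 ?addr0.
- rewrite [in RHS]free_liftP malg_linMr free_liftP mcoeffD mcoeffZ.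
  apply: (etrans (congr2 (fun u w => a *: u + w) IHx IHx')).
  by rewrite scalerDl !scalerDr !scalerA addrACA (mulrC a _@__).
rewrite malgMUU !free_liftU !mcoeffU1 !fmP fm1 /deg1 fmM.
case: k k' => [s] [[|v' [|w' s']]]; case: s => [|v [|w s]] /=;
  by rewrite ?scale0r ?scale1r ?scaler0 ?add0r ?addr0.
Qed.

(** The relations have neither constant term nor linear part, so the linear part vanishes on the
    whole ideal; on the quotient it is left inverse to the inclusion. *)
Lemma ext_incl_inj : injective (@ext_incl F V).
Proof.
have lift1 v : free_lift deg1 << fmu v >> = v by rewrite free_liftU /deg1 fmU.
have relc (r : freeAlg) : ext_rel r -> r@_mone = 0.
  move=> rr; apply: ext_ideal_const; apply/lspan_gen.
  by exists 1, r, 1; rewrite mulr1 mul1r.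
have gen0 v : (<< fmu v >> : freeAlg)@_mone = 0.
  by rewrite mcoeffU1 fmP fmU fm1.
have lift0 z : ext_ideal z -> free_lift deg1 z = 0.
  elim=> [|a u z' [x [r [y [rr ->]]]] _ IH]; first by rewrite linear0.
  rewrite linearP /= IH addr0 !free_deg1M [(x * r)@__]rmorphM /= (relc r rr).
  rewrite mulr0 !scale0r addr0 add0r; suff -> : free_lift deg1 r = 0 by rewrite !scaler0.
  case: rr => [v w|b v|v]; rewrite ?free_deg1M ?linearB ?linearZ /= ?lift1.
  - by rewrite addrAC addrK subrr.
  - by rewrite scalerN subrr.
  - by rewrite gen0 !scale0r addr0.
move=> v w; rewrite !ext_inclE => /eqP; rewrite -subr_eq0 -linearB => /eqP.
by move=> /ext_pi_eq0/lift0/eqP; rewrite linearB /= !lift1 subr_eq0 => /eqP.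
Qed.
End Degree1.

Section Product.
Fact ext_mul_linearl (y : E) : linear (fun x : E => x * y).
Proof. by move=> a x x'; rewrite mulrDl -scalerAl. Qed.
Fact ext_mul_linearr (x : E) : linear (fun y : E => x * y).
Proof. by move=> a y y'; rewrite mulrDr -scalerAr. Qed.
Definition ext_mul : {linear E ⊗ E -> E} :=
  tens_lift ext_mul_linearl ext_mul_linearr.
Lemma ext_mulE x y : ext_mul (x ⊗ₜ y) = x * y.
Proof. exact: tens_liftE. Qed.

Lemma ext_lmul_exists :
  {f : {linear V ⊗ E -> E} | forall v x, f (v ⊗ₜ x) = i v * x}.
Proof. by exists (ext_mul \o tmap i idfun) => v x /=; rewrite tmapE ext_mulE. Qed.
Definition ext_lmul := sval ext_lmul_exists.
Lemma ext_lmulE v x : ext_lmul (v ⊗ₜ x) = i v * x.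
Proof. exact: (svalP ext_lmul_exists). Qed.
Lemma ext_lmul_sqr v x : ext_lmul (v ⊗ₜ ext_lmul (v ⊗ₜ x)) = 0.
Proof. by rewrite !ext_lmulE mulrA ext_inc_sqr mul0r. Qed.

Lemma ext_rmul_exists :
  {f : {linear E ⊗ V -> E} | forall x v, f (x ⊗ₜ v) = x * i v}.
Proof. by exists (ext_mul \o tmap idfun i) => v x /=; rewrite tmapE ext_mulE. Qed.
Definition ext_rmul := sval ext_rmul_exists.
Lemma ext_rmulE x v : ext_rmul (x ⊗ₜ v) = x * i v.
Proof. exact: (svalP ext_rmul_exists). Qed.
End Product.

(** * Right actions, by reversing products *)

Section RightAction.

Fact tswap_subproof1 (U W : lmodType F) (w : W) : linear (fun u : U => w ⊗ₜ u).
Proof. exact: tensor_linearr. Qed.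
Fact tswap_subproof2 (U W : lmodType F) (u : U) : linear (fun w : W => w ⊗ₜ u).
Proof. exact: tensor_linearl. Qed.
Definition tswap (U W : lmodType F) : {linear U ⊗ W -> W ⊗ U} :=
  tens_lift (@tswap_subproof1 U W) (@tswap_subproof2 U W).
Lemma tswapE (U W : lmodType F) (u : U) (w : W) : tswap U W (u ⊗ₜ w) = w ⊗ₜ u.
Proof. exact: tens_liftE. Qed.

Let racts : {linear V ⊗ E -> E} := ext_rmul \o tswap V E.
Fact racts_sqr v x : racts (v ⊗ₜ racts (v ⊗ₜ x)) = 0.
Proof. by rewrite /= !tswapE !ext_rmulE -mulrA ext_inc_sqr mulr0. Qed.

(** The anti-automorphism that reverses products: vectors act on [E] by right multiplication, and
    the action is evaluated at the unit. It converts right actions into left ones. *)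
Definition ext_rev (x : E) : E := ext_act racts_sqr (x ⊗ₜ oneE).
Fact ext_rev_linear : linear ext_rev.
Proof. by move=> a x y; rewrite /ext_rev tensor_linearl linearP. Qed.
HB.instance Definition _ := GRing.isLinear.Build F E E *:%R ext_rev ext_rev_linear.

Lemma ext_rev1 : ext_rev 1 = 1.
Proof. exact: ext_act1. Qed.
Lemma ext_revMl v x : ext_rev (i v * x) = ext_rev x * i v.
Proof. by rewrite /ext_rev ext_actM /= tswapE ext_rmulE. Qed.
Lemma ext_revMr v x : ext_rev (x * i v) = i v * ext_rev x.
Proof.
elim/ext_ind_l: x => [|a x y IHx IHy|w x IH].
- by rewrite mul1r -[i v]mulr1 ext_revMl ext_rev1 mul1r !mulr1.
- by rewrite mulrDl -scalerAl !linearP /= IHx IHy mulrDr -scalerAr.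
- by rewrite -mulrA !ext_revMl IH mulrA.
Qed.

Variables (M : lmodType F) (ract : {linear M ⊗ V -> M}).
Hypothesis ract_sqr : forall v m, ract (ract (m ⊗ₜ v) ⊗ₜ v) = 0.

Let lact : {linear V ⊗ M -> M} := ract \o tswap V M.
Fact lact_sqr v m : lact (v ⊗ₜ lact (v ⊗ₜ m)) = 0.
Proof. by rewrite /= !tswapE ract_sqr. Qed.

Lemma ext_ract_exists : {A : {linear M ⊗ E -> M} |
  (forall m, A (m ⊗ₜ oneE) = m) &
  (forall m x v, A (m ⊗ₜ (x * i v)) = ract (A (m ⊗ₜ x) ⊗ₜ v))}.
Proof.
exists (ext_act lact_sqr \o tmap ext_rev idfun \o tswap M E) => [m|m x v] /=.
  by rewrite tswapE tmapE /= ext_rev1 ext_act1.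
by rewrite !tswapE !tmapE /= ext_revMr ext_actM /= tswapE.
Qed.
Definition ext_ract : {linear M ⊗ E -> M} := s2val ext_ract_exists.
Lemma ext_ract1 m : ext_ract (m ⊗ₜ oneE) = m.
Proof. exact: (s2valP ext_ract_exists). Qed.
Lemma ext_ractM m x v :
  ext_ract (m ⊗ₜ (x * i v)) = ract (ext_ract (m ⊗ₜ x) ⊗ₜ v).
Proof. exact: (s2valP' ext_ract_exists). Qed.
End RightAction.

End ExteriorUniversal.

(** * Operators on iterated tensor products *)

(* Unifying [0], [+] or [*:] with the concrete operations of [ext V] or of a
   tensor product is very slow, so linearity is used by syntactic matching and
   the unit of [ext V] is abstracted beforehand. *)
Ltac hide1 := repeat match goal with
  |- context [@GRing.one ?R] => generalize (@GRing.one R); intro end.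
Ltac lin0 := repeat match goal with
  | |- context [0 * ?x] => rewrite (mul0r x)
  | |- context [?x * 0] => rewrite (mulr0 x)
  | |- context [@tensor ?F ?U ?W 0 ?w] => rewrite (@tensor0l F U W w)
  | |- context [@tensor ?F ?U ?W ?u 0] => rewrite (@tensor0r F U W u)
  | |- context [GRing.Linear.sort ?f 0] => rewrite (linear0 f)
  | |- context [@tmap ?F ?U ?U' ?W ?W' ?f ?g 0] =>
      rewrite (linear0 (@tmap F U U' W W' f g) : @tmap F U U' W W' f g 0 = 0)
  | |- context [@tassoc ?F ?U ?V ?W 0] =>
      rewrite (linear0 (@tassoc F U V W) : @tassoc F U V W 0 = 0)
  | |- context [@tassocV ?F ?U ?V ?W 0] =>
      rewrite (linear0 (@tassocV F U V W) : @tassocV F U V W 0 = 0)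
  end.
Ltac linD := repeat match goal with
  | |- context [@tensor ?F ?U ?W (?a + ?b) ?w] => rewrite (@tensorDl F U W a b w)
  | |- context [@tensor ?F ?U ?W ?u (?a + ?b)] => rewrite (@tensorDr F U W u a b)
  | |- context [GRing.Linear.sort ?f (?a + ?b)] => rewrite (linearD f a b)
  | |- context [@tmap ?F ?U ?U' ?W ?W' ?f ?g (?a + ?b)] =>
      rewrite (linearD (@tmap F U U' W W' f g) a b :
        @tmap F U U' W W' f g (a + b) = @tmap F U U' W W' f g a + @tmap F U U' W W' f g b)
  | |- context [@tassoc ?F ?U ?V ?W (?a + ?b)] =>
      rewrite (linearD (@tassoc F U V W) a b :
        @tassoc F U V W (a + b) = @tassoc F U V W a + @tassoc F U V W b)
  | |- context [@tassocV ?F ?U ?V ?W (?a + ?b)] =>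
      rewrite (linearD (@tassocV F U V W) a b :
        @tassocV F U V W (a + b) = @tassocV F U V W a + @tassocV F U V W b)
  end.
Ltac linZ := repeat match goal with
  | |- context [@tensor ?F ?U ?W (?a *: ?b) ?w] => rewrite (@tensorZl F U W a b w)
  | |- context [@tensor ?F ?U ?W ?u (?a *: ?b)] => rewrite (@tensorZr F U W a u b)
  | |- context [GRing.Linear.sort ?f (?a *: ?b)] => rewrite (linearZZ f a b)
  end.
Ltac tlin := elim/tens_ind;
  [ | by hide1; lin0; rewrite /= ?(scaler0, oppr0) ?addr0
  | hide1;
    let t1 := fresh in let t2 := fresh in let H1 := fresh in let H2 := fresh in
    move=> t1 t2 /= H1 H2; linD; rewrite ?H1 ?H2 ?addr0 // ].
Ltac elin := let a := fresh in let x := fresh in let y := fresh in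
  let H1 := fresh in let H2 := fresh in
  move=> a x y H1 H2 *; linD; linZ; rewrite H1 H2 //=.

Section Heads.
Variable F : fieldType.
Implicit Types X Y Z U W M N : lmodType F.

(* In a right-bracketed tensor product, thead and tfront act on the first two
   factors and ttail on all but the first. Like tensor itself, operators are
   introduced by opaque existence statements, to keep simplification from
   unfolding them. *)
Lemma thead_exists X Y W M (A : {linear X ⊗ Y -> W}) :
  {f : {linear X ⊗ (Y ⊗ M) -> W ⊗ M} |
   forall x y m, f (x ⊗ₜ (y ⊗ₜ m)) = A (x ⊗ₜ y) ⊗ₜ m}.
Proof. by exists (tmap A idfun \o tassocV) => x y m /=; rewrite tassocVE tmapE. Qed.
Definition thead X Y W M (A : {linear X ⊗ Y -> W}) := sval (thead_exists M A).
Lemma theadE X Y W M (A : {linear X ⊗ Y -> W}) x y (m : M) :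
  thead M A (x ⊗ₜ (y ⊗ₜ m)) = A (x ⊗ₜ y) ⊗ₜ m.
Proof. exact: (svalP (thead_exists M A)). Qed.

Lemma tfront_exists X Y U W M (A : {linear X ⊗ Y -> U ⊗ W}) :
  {f : {linear X ⊗ (Y ⊗ M) -> U ⊗ (W ⊗ M)} |
   forall x y m, f (x ⊗ₜ (y ⊗ₜ m)) = tassoc (A (x ⊗ₜ y) ⊗ₜ m)}.
Proof. by exists (tassoc \o thead M A) => x y m; rewrite /= theadE. Qed.
Definition tfront X Y U W M (A : {linear X ⊗ Y -> U ⊗ W}) := sval (tfront_exists M A).
Lemma tfrontE X Y U W M (A : {linear X ⊗ Y -> U ⊗ W}) x y (m : M) :
  tfront M A (x ⊗ₜ (y ⊗ₜ m)) = tassoc (A (x ⊗ₜ y) ⊗ₜ m).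
Proof. exact: (svalP (tfront_exists M A)). Qed.

Lemma ttail_exists X M N (A : {linear M -> N}) :
  {f : {linear X ⊗ M -> X ⊗ N} | forall x m, f (x ⊗ₜ m) = x ⊗ₜ A m}.
Proof. by exists (tmap idfun A) => x m /=; rewrite tmapE. Qed.
Definition ttail X M N (A : {linear M -> N}) := sval (ttail_exists X A).
Lemma ttailE X M N (A : {linear M -> N}) x m : ttail X A (x ⊗ₜ m) = x ⊗ₜ A m.
Proof. exact: (svalP (ttail_exists X A)). Qed.

Lemma tpair_exists X Y U W (f : {linear X -> U}) (h : {linear Y -> W}) :
  {k : {linear X ⊗ Y -> U ⊗ W} | forall x y, k (x ⊗ₜ y) = f x ⊗ₜ h y}.
Proof. by exists (tmap f h) => x y /=; rewrite tmapE. Qed.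
Definition tpair X Y U W (f : {linear X -> U}) (h : {linear Y -> W}) :=
  sval (tpair_exists f h).
Lemma tpairE X Y U W (f : {linear X -> U}) (h : {linear Y -> W}) x y :
  tpair f h (x ⊗ₜ y) = f x ⊗ₜ h y.
Proof. exact: (svalP (tpair_exists f h)). Qed.

Lemma ttail_id X M (A : {linear M -> M}) : A =1 idfun -> ttail X A =1 idfun.
Proof. by move=> A1; apply: tens_eq => x m; rewrite ttailE A1. Qed.

Lemma ttail_eq X M N (A B : {linear M -> N}) : A =1 B -> ttail X A =1 ttail X B.
Proof. by move=> AB; apply: tens_eq => x m; rewrite !ttailE AB. Qed.

Lemma ttail_comp X M N W (A : {linear M -> N}) (B : {linear N -> W}) t :
  ttail X B (ttail X A t) = ttail X (B \o A) t.
Proof. by move: t; tlin => x m; rewrite !ttailE. Qed.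

Lemma ttail_sq X M N N' W (A : {linear M -> N}) (B : {linear N -> W})
    (A' : {linear M -> N'}) (B' : {linear N' -> W}) t :
  (forall m, B (A m) = B' (A' m)) -> ttail X B (ttail X A t) = ttail X B' (ttail X A' t).
Proof. by move=> eAB; rewrite !ttail_comp; apply: ttail_eq. Qed.

Lemma thead_ttail X Y W M N (A : {linear X ⊗ Y -> W}) (g : {linear M -> N}) t :
  thead N A (ttail X (ttail Y g) t) = ttail W g (thead M A t).
Proof.
move: t; tlin => x; tlin => y m.
by rewrite !(ttailE, theadE).
Qed.

Lemma tfront_ttail X Y U W M N (A : {linear X ⊗ Y -> U ⊗ W}) (g : {linear M -> N}) t :
  tfront N A (ttail X (ttail Y g) t) = ttail U (ttail W g) (tfront M A t).
Proof.
move: t; tlin => x; tlin => y m; rewrite !(ttailE, tfrontE).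
by move: (A _); tlin => u w; rewrite !tassocE !ttailE.
Qed.
End Heads.

Section Recursion.
Variables (F : fieldType) (V M : lmodType F) (A : {linear V ⊗ M -> M}).
Hypothesis A_sqr : forall v m, A (v ⊗ₜ A (v ⊗ₜ m)) = 0.
Local Notation oneE := (1 : ext V).

(** The second clause says that [b] intertwines left multiplication by vectors with [A]; later
    recursions keep this form. *)
Lemma ext_thead_rec (X : lmodType F) (f : {linear X -> M}) :
  {b : {linear (ext V : lmodType F) ⊗ X -> M} | (forall x, b (oneE ⊗ₜ x) = f x) &
     (forall t, b (thead X (ext_lmul V) t) = A (ttail V b t))}.
Proof.
have [b bE] : {b : {linear (ext V : lmodType F) ⊗ X -> M} |
    forall y x, b (y ⊗ₜ x) = ext_act A_sqr (y ⊗ₜ f x)}.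
  by exists (ext_act A_sqr \o tmap idfun f) => y x; rewrite /= tmapE.
exists b => [x|]; first by rewrite bE ext_act1.
tlin => v; tlin => y x.
by rewrite theadE ext_lmulE ttailE !bE ext_actM.
Qed.

Lemma ext_rec (m : M) :
  {f : {linear (ext V : lmodType F) -> M} | f 1 = m & forall t, f (ext_lmul V t) = A (ttail
    V f t)}.
Proof.
have [f fE] : {f : {linear (ext V : lmodType F) -> M} | forall y, f y = ext_act A_sqr (y ⊗ₜ
  m)}.
  by exists (ext_act A_sqr \o (tswap M (ext V) \o tensor m)) => y; rewrite /= tswapE.
exists f => [|]; first by rewrite fE ext_act1.
by tlin => v y; rewrite ext_lmulE ttailE !fE ext_actM.
Qed.
End Recursion.

(** * Braiding a vector past the exterior algebra *)

(* The last two fields say that a bilinear map on V that vanishes on the squares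
   v ⊗ v factors through tau + 1. *)
Record exterior_braiding (F : fieldType) (V : lmodType F)
    (tau : {linear V ⊗ V -> V ⊗ V}) := ExteriorBraiding {
  tau_ybe : forall t : V ⊗ (V ⊗ V),
    tfront V tau (ttail V tau (tfront V tau t)) = ttail V tau (tfront V tau (ttail V tau t));
  tau_diag : forall v, tau (v ⊗ₜ v) = - (v ⊗ₜ v);
  tau_split : {linear V ⊗ V -> V ⊗ V};
  tau_splitP : forall t,
    lspan (fun x => exists v, x = v ⊗ₜ v) (t - tau_split (t + tau t)) }.

Section GeneratorBraiding.
Variables (F : fieldType) (V : lmodType F).
Variables (tau : {linear V ⊗ V -> V ⊗ V}) (tauP : exterior_braiding tau).

Local Notation E := (ext V : lmodType F).
Local Notation oneE := (1 : ext V).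
Local Notation i := (@ext_inc F V).
Local Notation lX := (thead _ (@ext_lmul F V)).
Local Notation rX := (thead _ (@ext_rmul F V)).

Local Notation e0 := (tau_split tauP).

(** The difference of the two arguments is a combination of squares in the first two factors, which
    [C] kills. In particular [C] vanishes wherever [tau] acts as [-1]. *)
Lemma alternatingE (M N : lmodType F) (C : {linear V ⊗ (V ⊗ M) -> N}) :
  (forall v m, C (v ⊗ₜ (v ⊗ₜ m)) = 0) ->
  forall t, C t = C (tfront M e0 (t + tfront M tau t)).
Proof.
move=> C0 t; apply/eqP; rewrite -subr_eq0 -linearB; apply/eqP; move: t.
have C0s m s : lspan (fun x => exists v, x = v ⊗ₜ v) s -> C (tassoc (s ⊗ₜ m)) = 0.
  move: s; apply: lspan_sub => [|a x y Px Py|x [v ->]].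
  - by rewrite tensor0l !linear0.
  - by rewrite tensor_linearl !linearP /= Px Py scaler0 addr0.
  - by rewrite tassocE C0.
have alt (A : {linear V ⊗ V -> V ⊗ V}) q (m : M) :
    tfront M A (tassoc (q ⊗ₜ m)) = tassoc (A q ⊗ₜ m).
  by move: q; tlin => v w; rewrite tassocE tfrontE.
(* Bundling the difference as one linear map allows the reduction to pure tensors. *)
have [D DE] : exists D : {linear V ⊗ (V ⊗ M) -> N},
    forall t, D t = C (t - tfront M e0 (t + tfront M tau t)).
  by exists (C \o (idfun \- (tfront M e0 \o (idfun \+ tfront M tau)))).
move=> t; rewrite -DE; move: t; tlin => v; tlin => w m; rewrite DE.
rewrite -tassocE alt -linearD -tensorDl alt -linearB.
have -> : v ⊗ₜ w ⊗ₜ m - e0 (v ⊗ₜ w + tau (v ⊗ₜ w)) ⊗ₜ m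
    = (v ⊗ₜ w - e0 (v ⊗ₜ w + tau (v ⊗ₜ w))) ⊗ₜ m.
  by rewrite -scaleN1r -tensorZl scaleN1r -tensorDl.
exact/C0s/tau_splitP.
Qed.

(** The rebracketing [as3] detaches [M], so that both sides become operators on [V ⊗ (V ⊗ V)]
    tensored with the identity of [M]. *)
Lemma tau_ybe_tfront (M : lmodType F) (t : V ⊗ (V ⊗ (V ⊗ M))) :
  tfront _ tau (ttail V (tfront M tau) (tfront _ tau t))
    = ttail V (tfront M tau) (tfront _ tau (ttail V (tfront M tau) t)).
Proof.
have [as3 as3E [as3V as3K]] : exists2 as3 :
    {linear (V ⊗ (V ⊗ V)) ⊗ M -> V ⊗ (V ⊗ (V ⊗ M))},
    forall u s m, as3 (u ⊗ₜ s ⊗ₜ m) = u ⊗ₜ tassoc (s ⊗ₜ m) &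
    exists as3V, cancel as3V as3.
  exists (ttail V (@tassoc F V V M) \o tassoc) => [u s m|].
    by rewrite /= tassocE ttailE.
  exists (tassocV \o ttail V (@tassocV F V V M)) => s; rewrite /= tassocVK ttail_comp.
  by rewrite ttail_id // => u; rewrite /= tassocVK.
have alas A (s : (V ⊗ (V ⊗ V)) ⊗ M) : tfront _ A (as3 s) = as3 (tmap (tfront V A) idfun s).
  move: s; tlin => s m; rewrite tmapE /=; move: s; tlin => u; tlin => v w.
  rewrite as3E tassocE !tfrontE.
  by move: (A _); tlin => v' w'; rewrite !tassocE as3E tassocE.
have rapas (A : {linear V ⊗ V -> V ⊗ V}) (s : (V ⊗ (V ⊗ V)) ⊗ M) :
    ttail V (tfront _ A) (as3 s) = as3 (tmap (ttail V A) idfun s).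
  move: s; tlin => s m; rewrite tmapE /=; move: s; tlin => u; tlin => v w.
  rewrite as3E !ttailE tassocE tfrontE as3E.
  by move: (A _); tlin => v' w'; rewrite !tassocE.
rewrite -(as3K t) !(alas, rapas); congr (as3 _); move: (as3V t).
by tlin => s m; rewrite !tmapE /= (tau_ybe tauP).
Qed.

(** By the Yang-Baxter equation, [tau] applied after [w] has passed [v ⊗ v] equals [tau] applied to
    [v ⊗ v] beforehand, that is [-1]. So the two vectors multiplied into [E] form a tensor on which
    [tau] is [-1], and [alternatingE] gives zero. *)
Fact right_step_sqr v (m : E ⊗ V) :
  rX (ttail E tau (tassoc (rX (ttail E tau (tassoc (m ⊗ₜ v))) ⊗ₜ v))) = 0.
Proof.
move: m; tlin => x w; rewrite tassocE ttailE.
pose s := w ⊗ₜ (v ⊗ₜ v).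
have -> : rX (ttail E tau (tassoc (rX (x ⊗ₜ tau (w ⊗ₜ v)) ⊗ₜ v)))
   = rX (rX (x ⊗ₜ (ttail V tau (tfront V tau s)))).
  rewrite tfrontE; move: (tau _); tlin => v' w'.
  rewrite theadE ext_rmulE !tassocE !ttailE.
  by move: (tau _); tlin => v1 w1; rewrite !theadE !ext_rmulE.
have := @alternatingE V (E ⊗ V) (rX \o rX \o tensor x).
rewrite /= => ->; last by move=> u m;
  rewrite !theadE !ext_rmulE -mulrA ext_inc_sqr mulr0 tensor0l.
rewrite (tau_ybe tauP) [ttail V tau s]ttailE (tau_diag tauP).
by rewrite !linearN /= subrr !linear0.
Qed.

(* g (v ⊗ x) moves the vector v to the right of x. *)
Lemma gen_braid_exists : {g : {linear V ⊗ E -> E ⊗ V} |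
  (forall v, g (v ⊗ₜ oneE) = oneE ⊗ₜ v) &
  (forall v x w, g (v ⊗ₜ (x * i w)) = rX (ttail E tau (tassoc (g (v ⊗ₜ x) ⊗ₜ w))))}.
Proof.
pose step : {linear (E ⊗ V) ⊗ V -> E ⊗ V} := rX \o ttail E tau \o tassoc.
exists (@ext_ract _ _ _ step right_step_sqr \o tmap (tensor oneE) idfun) => [v|v x w] /=.
  by rewrite tmapE ext_ract1.
by rewrite !tmapE ext_ractM.
Qed.
Definition gen_braid := s2val gen_braid_exists.
Local Notation g := gen_braid.

Lemma gen_braid1 v : g (v ⊗ₜ oneE) = oneE ⊗ₜ v.
Proof. exact: (s2valP gen_braid_exists). Qed.

Lemma gen_braidMr v x w :
  g (v ⊗ₜ (x * i w)) = rX (ttail E tau (tassoc (g (v ⊗ₜ x) ⊗ₜ w))).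
Proof. exact: (s2valP' gen_braid_exists). Qed.

Lemma gen_braidE v w : g (v ⊗ₜ i w) = tpair i idfun (tau (v ⊗ₜ w)).
Proof.
rewrite -[i w]mul1r gen_braidMr gen_braid1 tassocE ttailE.
by move: (tau _); tlin => v' w'; rewrite theadE ext_rmulE mul1r tpairE.
Qed.

Section Suffix.
Variables M : lmodType F.
Lemma tfront_gen1 v (m : M) : tfront M g (v ⊗ₜ (oneE ⊗ₜ m)) = oneE ⊗ₜ (v ⊗ₜ m).
Proof. by rewrite tfrontE gen_braid1 tassocE. Qed.

Lemma tfront_gen_rX (t : V ⊗ (E ⊗ (V ⊗ M))) :
  tfront M g (ttail V rX t) = rX (ttail E (tfront M tau) (tfront _ g t)).
Proof.
move: t; tlin => v; tlin => x; tlin => w m.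
rewrite !(ttailE, theadE, tfrontE) ext_rmulE gen_braidMr.
move: (g _); tlin => y u; rewrite !tassocE !ttailE !tfrontE.
by move: (tau _); tlin => u' w'; rewrite !tassocE !theadE !tassocE.
Qed.
End Suffix.

Lemma lX_rX (M : lmodType F) (t : V ⊗ (E ⊗ (V ⊗ M))) : lX (ttail V rX t) = rX (lX t).
Proof.
move: t; tlin => v; tlin => x; tlin => w m.
by rewrite !(ttailE, theadE) !(ext_rmulE, ext_lmulE) mulrA.
Qed.

(** [gen_braid] was defined by recursion on the right end of [x]; this is its rule at the left end,
    on which the later recursions rest. The induction strips [u] from the right of [x] and hands it
    to the suffix. *)
Lemma tfront_gen_lX (M : lmodType F) (t : V ⊗ (V ⊗ (E ⊗ M))) :
  tfront M g (ttail V lX t) = lX (ttail V (tfront M g) (tfront _ tau t)).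
Proof.
move: t; tlin => v; tlin => w; tlin => x m.
elim/ext_ind_r: x M m v w => [M m v w||x u IH M m v w]; [|by elin|].
  rewrite !(ttailE, theadE, tfrontE) ext_lmulE mulr1 gen_braidE.
  by move: (tau _); tlin => w' v';
    rewrite tpairE !tassocE ttailE tfront_gen1 theadE ext_lmulE mulr1.
have -> : v ⊗ₜ (w ⊗ₜ ((x * i u) ⊗ₜ m)) = ttail V (ttail V rX) (v ⊗ₜ (w ⊗ₜ (x ⊗ₜ (u ⊗ₜ m)))).
  by rewrite !ttailE theadE ext_rmulE.
move: (IH _ (u ⊗ₜ m) v w); set s := v ⊗ₜ _ => {}IH.
rewrite tfront_ttail (ttail_sq _ (@lX_rX M)) tfront_gen_rX IH -thead_ttail.
rewrite (@ttail_sq _ _ _ _ _ _ _ _ (ttail E (tfront M tau) \o tfront _ g) rX) -?ttail_comp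
  ?lX_rX //.
exact: tfront_gen_rX.
Qed.

Definition two_gen (M : lmodType F) (t : V ⊗ (V ⊗ (E ⊗ M))) : E ⊗ (V ⊗ (V ⊗ M)) :=
  tfront _ g (ttail V (tfront M g) t).

(** Each vector stripped from [x] costs one instance of the Yang-Baxter equation,
    [tau_ybe_tfront]. *)
Lemma gen_braid_ybe (M : lmodType F) (t : V ⊗ (V ⊗ (E ⊗ M))) :
  two_gen (tfront _ tau t) = ttail E (tfront M tau) (two_gen t).
Proof.
rewrite /two_gen; move: t; tlin => v; tlin => w; tlin => x m.
elim/ext_ind_r: x M m v w => [M m v w||x u IH M m v w]; [|by elin|].
  rewrite ttailE !tfront_gen1 ttailE !tfrontE.
  by move: (tau _); tlin => w' v'; rewrite !tassocE ttailE !tfront_gen1.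
have -> : v ⊗ₜ (w ⊗ₜ ((x * i u) ⊗ₜ m)) = ttail V (ttail V rX) (v ⊗ₜ (w ⊗ₜ (x ⊗ₜ (u ⊗ₜ m)))).
  by rewrite !ttailE theadE ext_rmulE.
move: (IH _ (u ⊗ₜ m) v w); set s := v ⊗ₜ _ => {}IH.
have step s' : tfront _ g (ttail V (tfront M g) (ttail V (ttail V rX) s')) =
    rX (ttail E (tfront _ tau) (ttail E (ttail V (tfront M tau)) (tfront _ g (ttail V
      (tfront _ g) s')))).
  rewrite (@ttail_sq _ _ _ _ _ _ _ _ (ttail E (tfront M tau) \o tfront _ g) rX).
    by rewrite -ttail_comp tfront_gen_rX tfront_ttail.
  exact: tfront_gen_rX.
rewrite tfront_ttail !step IH -thead_ttail; congr (rX _).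
by rewrite !ttail_comp; apply: ttail_eq => q; rewrite /= tau_ybe_tfront.
Qed.

End GeneratorBraiding.

(** * Operators that push a vector past E *)

Section Pushing.
Variables (F : fieldType) (V : lmodType F).
Variables (tau : {linear V ⊗ V -> V ⊗ V}) (tauP : exterior_braiding tau).

Local Notation E := (ext V : lmodType F).
Local Notation oneE := (1 : ext V).
Local Notation i := (@ext_inc F V).
Local Notation lX := (thead _ (@ext_lmul F V)).
Local Notation rX := (thead _ (@ext_rmul F V)).
Local Notation mX := (thead _ (@ext_mul F V)).
Local Notation g := (gen_braid tauP).

(** The hexagon with one strand a vector; through [mX_push_push] it yields [braid_mulr]. *)
Lemma tfront_gen_mX (M : lmodType F) (t : V ⊗ (E ⊗ (E ⊗ M))) :
  tfront M g (ttail V mX t) = mX (ttail E (tfront M g) (tfront _ g t)).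
Proof.
move: t; tlin => v; tlin => x; tlin => y m.
elim/ext_ind_r: y M m v x => [M m v x||y u IH M m v x]; [|by elin|].
  rewrite ttailE theadE ext_mulE mulr1 !tfrontE.
  by move: (g _); tlin => y u; rewrite !tassocE ttailE tfront_gen1 theadE ext_mulE mulr1.
have -> : v ⊗ₜ (x ⊗ₜ ((y * i u) ⊗ₜ m)) = ttail V (ttail E rX) (v ⊗ₜ (x ⊗ₜ (y ⊗ₜ (u ⊗ₜ m)))).
  by rewrite !ttailE theadE ext_rmulE.
move: (IH _ (u ⊗ₜ m) v x); set s := v ⊗ₜ _ => {}IH.
have mX_rX N (t : E ⊗ (E ⊗ (V ⊗ N))) : mX (ttail E rX t) = rX (mX t).
  move: t; tlin => x1; tlin => x2; tlin => w n.
  by rewrite !(ttailE, theadE) !(ext_rmulE, ext_mulE) mulrA.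
rewrite tfront_ttail (ttail_sq _ (@mX_rX M)) tfront_gen_rX IH -thead_ttail.
rewrite (@ttail_sq _ _ _ _ _ _ _ _ (ttail E (tfront M tau) \o tfront _ g) rX) -?ttail_comp
  ?mX_rX //.
exact: tfront_gen_rX.
Qed.

(* push A moves a vector past the factor E, then applies A. *)
Lemma push_exists (M N : lmodType F) (A : {linear V ⊗ M -> N}) :
  {f : {linear V ⊗ (E ⊗ M) -> E ⊗ N} | forall t, f t = ttail E A (tfront M g t)}.
Proof. by exists (ttail E A \o tfront M g). Qed.
Definition push M N A := sval (@push_exists M N A).
Lemma pushE (M N : lmodType F) (A : {linear V ⊗ M -> N}) t :
  push A t = ttail E A (tfront M g t).
Proof. exact: (svalP (push_exists A)). Qed.

Lemma push1 (M N : lmodType F) (A : {linear V ⊗ M -> N}) v m :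
  push A (v ⊗ₜ (oneE ⊗ₜ m)) = oneE ⊗ₜ A (v ⊗ₜ m).
Proof. by rewrite pushE tfront_gen1 ttailE. Qed.

Lemma push_eq (M N : lmodType F) (A B : {linear V ⊗ M -> N}) :
  A =1 B -> push A =1 push B.
Proof. by move=> AB t; rewrite !pushE; apply: ttail_eq. Qed.

Lemma pushD (M N : lmodType F) (A B : {linear V ⊗ M -> N}) t :
  push (A \+ B) t = push A t + push B t.
Proof.
rewrite !pushE; move: (tfront M g t); elim/tens_ind => [x m||x y IHx IHy].
- by rewrite !ttailE -tensorDr.
- by rewrite !linear0 addr0.
- by rewrite !linearD IHx IHy /= addrACA.
Qed.

Lemma pushZ (M N : lmodType F) (A : {linear V ⊗ M -> N}) c t :
  push (c \*: A) t = c *: push A t.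
Proof.
rewrite !pushE; move: (tfront M g t); tlin => [x m|]; last by rewrite scalerDr.
by rewrite !ttailE tensorZr.
Qed.

Lemma ttail_push (M N N' : lmodType F) (A : {linear V ⊗ M -> N})
    (B : {linear N -> N'}) t : ttail E B (push A t) = push (B \o A) t.
Proof. by rewrite !pushE ttail_comp. Qed.

Lemma push_ttail (M M' N : lmodType F) (A : {linear V ⊗ M -> N})
    (B : {linear M' -> M}) t :
  push A (ttail V (ttail E B) t) = push (A \o ttail V B) t.
Proof. by rewrite !pushE tfront_ttail ttail_comp. Qed.

Lemma mX_push_push (M N : lmodType F) (A : {linear V ⊗ M -> N}) t :
  mX (push (push A) t) = push A (ttail V mX t).
Proof.
rewrite !pushE tfront_gen_mX -thead_ttail !ttail_comp; congr (mX _).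
by apply: ttail_eq => u; rewrite /= pushE.
Qed.

Lemma push_push (M N N' : lmodType F) (A : {linear V ⊗ M -> N})
    (B : {linear V ⊗ N -> N'}) t :
  push B (ttail V (push A) t) = ttail E (B \o ttail V A) (two_gen tauP t).
Proof.
rewrite (@ttail_eq _ _ _ _ _ (ttail E A \o tfront M g)) => [|u]; last by rewrite /= pushE.
by rewrite -ttail_comp pushE tfront_ttail ttail_comp.
Qed.

Lemma tfront_tau_diag (M : lmodType F) v (m : M) :
  tfront M tau (v ⊗ₜ (v ⊗ₜ m)) = - (v ⊗ₜ (v ⊗ₜ m)).
Proof. by rewrite tfrontE (tau_diag tauP) -scaleN1r tensorZl linearZ /= tassocE scaleN1r. Qed.

Definition sqr_zero (M : lmodType F) (A : {linear V ⊗ M -> M}) :=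
  forall v m, A (v ⊗ₜ A (v ⊗ₜ m)) = 0.

Lemma push_sqr (M : lmodType F) (A : {linear V ⊗ M -> M}) :
  sqr_zero A -> sqr_zero (push A).
Proof.
move=> AA v t; set s := v ⊗ₜ (v ⊗ₜ t).
have -> : v ⊗ₜ push A (v ⊗ₜ t) = ttail V (push A) s by rewrite ttailE.
(* [A] after [A] kills squares, so it is rewritten through [1 + tau]; [gen_braid_ybe] then moves
   [1 + tau] back onto [v ⊗ v]. *)
have C0 := alternatingE tauP (C := A \o ttail V A).
rewrite push_push (@ttail_eq _ _ _ _ _ (A \o ttail V A \o tfront M (tau_split tauP) \o
  (idfun \+ tfront M tau))).
  rewrite -ttail_comp.
  have -> : ttail E (idfun \+ tfront M tau) (two_gen tauP s) = two_gen tauP s + ttail E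
    (tfront M tau) (two_gen tauP s).
    move: (two_gen tauP s); elim/tens_ind => [x m||x y IHx IHy].
    - by rewrite !ttailE -tensorDr.
    - by rewrite !linear0 addr0.
    - by rewrite !linearD IHx IHy /= addrACA.
  by rewrite -gen_braid_ybe tfront_tau_diag /two_gen !linearN subrr !linear0.
by move=> u; apply: C0 => w m; rewrite /= ttailE AA.
Qed.

(* B intertwines inserting w before and after, up to exchanging v and w by tau. *)
Definition tau_equivariant (M N : lmodType F) (B : {linear V ⊗ M -> N})
    (A1 : {linear V ⊗ M -> M}) (A2 : {linear V ⊗ N -> N}) :=
  forall t, B (ttail V A1 t) = A2 (ttail V B (tfront _ tau t)).

Lemma tau_equivariant_lX (M N : lmodType F) (A : {linear V ⊗ M -> N}) :
  tau_equivariant (push A) lX lX.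
Proof.
move=> t; rewrite pushE tfront_gen_lX -thead_ttail ttail_comp; congr (lX _).
by apply: ttail_eq => u; rewrite /= pushE.
Qed.

(** By [gen_braid_ybe] the exchange by [tau] can wait until both vectors have passed [E], where the
    hypothesis applies. *)
Lemma tau_equivariant_push (M N : lmodType F) (B : {linear V ⊗ M -> N}) A1 A2 :
  tau_equivariant B A1 A2 -> tau_equivariant (push B) (push A1) (push A2).
Proof.
move=> BA t; rewrite !push_push gen_braid_ybe ttail_comp.
by apply: ttail_eq => u; rewrite /= BA.
Qed.

Lemma rapD (X M N : lmodType F) (A B : {linear M -> N}) t :
  ttail X (A \+ B) t = ttail X A t + ttail X B t.
Proof.
move: t; elim/tens_ind => [x m||x y IHx IHy].
- by rewrite !ttailE -tensorDr.
- by rewrite !linear0 addr0.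
- by rewrite !linearD IHx IHy /= addrACA.
Qed.

(* The action of a primitive vector on the braided tensor product E ⊗ M. *)
Lemma twist_exists (M : lmodType F) (A : {linear V ⊗ M -> M}) :
  {f : {linear V ⊗ (E ⊗ M) -> E ⊗ M} | forall t, f t = lX t + push A t}.
Proof. by exists (lX \+ push A). Qed.
Definition twist (M : lmodType F) A := sval (@twist_exists M A).
Lemma twistE (M : lmodType F) (A : {linear V ⊗ M -> M}) t :
  twist A t = lX t + push A t.
Proof. exact: (svalP (twist_exists A)). Qed.

Lemma push_twist (M : lmodType F) (A : {linear V ⊗ M -> M}) t :
  push (twist A) t = push lX t + push (push A) t.
Proof. by rewrite -pushD; apply: push_eq => u; exact: twistE. Qed.

Lemma tau_equivariant_twist (M N : lmodType F) (B : {linear V ⊗ (E ⊗ M) -> E ⊗ N})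
    (A : {linear V ⊗ M -> M}) (A' : {linear V ⊗ N -> N}) :
  tau_equivariant B lX lX -> tau_equivariant B (push A) (push A') ->
  tau_equivariant B (twist A) (twist A').
Proof.
move=> BX BA t; rewrite (@ttail_eq _ _ _ _ _ (lX \+ push A)) => [|u]; last exact: twistE.
by rewrite rapD linearD /= BX BA twistE.
Qed.

Lemma twist_sqr (M : lmodType F) (A : {linear V ⊗ M -> M}) :
  sqr_zero A -> sqr_zero (twist A).
Proof.
move=> AA v t; rewrite !twistE tensorDr !linearD /= (push_sqr AA) addr0.
have -> : lX (v ⊗ₜ lX (v ⊗ₜ t)) = 0.
  by move: t; tlin => x m; rewrite !theadE -(tensor0l _ m) !ext_lmulE mulrA ext_inc_sqr mul0r.
have -> : v ⊗ₜ lX (v ⊗ₜ t) = ttail V lX (v ⊗ₜ (v ⊗ₜ t)) by rewrite ttailE.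
(* The two cross terms remain. Exchanging insertion and push costs one [tau], which is [-1] on
   [v ⊗ v], so they cancel. *)
by rewrite tau_equivariant_lX tfront_tau_diag !linearN /= ttailE add0r subrr.
Qed.

(* By recursion on the factor E: a map commuting with the insertion of a vector
   is determined by its effect at 1. *)
Lemma push_equivariance (M M1 N N1 : lmodType F) (A : {linear V ⊗ M -> M1})
    (P : {linear E ⊗ M -> N}) (P' : {linear E ⊗ M1 -> N1})
    (Q : {linear V ⊗ N -> N1}) (G : {linear V ⊗ N -> N}) (G' : {linear V ⊗ N1 -> N1}) :
  (forall t, P (lX t) = G (ttail V P t)) ->
  (forall t, P' (lX t) = G' (ttail V P' t)) ->
  tau_equivariant Q G G' ->
  (forall v m, P' (oneE ⊗ₜ A (v ⊗ₜ m)) = Q (v ⊗ₜ P (oneE ⊗ₜ m))) ->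
  forall t, P' (push A t) = Q (ttail V P t).
Proof.
move=> PG PG' QG base; tlin => v; tlin => x m.
elim/ext_ind_l: x v => [v||w x IH v]; [by rewrite push1 ttailE base|by elin|].
have -> : (i w * x) ⊗ₜ m = lX (w ⊗ₜ (x ⊗ₜ m)) by rewrite theadE ext_lmulE.
have -> : v ⊗ₜ lX (w ⊗ₜ (x ⊗ₜ m)) = ttail V lX (v ⊗ₜ (w ⊗ₜ (x ⊗ₜ m))).
  by rewrite ttailE.
rewrite tau_equivariant_lX PG' ttail_comp (ttail_sq (A' := ttail V P) (B' := G)) //.
rewrite QG; congr (G' _); rewrite !ttailE !tfrontE.
by move: (tau _); tlin => w' v'; rewrite !tassocE !ttailE /= IH ttailE.
Qed.
End Pushing.

(** * The braiding *)

Section Braiding.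
Variables (F : fieldType) (V : lmodType F).
Variables (tau : {linear V ⊗ V -> V ⊗ V}) (tauP : exterior_braiding tau).

Local Notation E := (ext V : lmodType F).
Local Notation oneE := (1 : ext V).
Local Notation i := (@ext_inc F V).
Local Notation mul := (@ext_mul F V).
Local Notation lm := (@ext_lmul F V).
Local Notation lX := (thead _ (@ext_lmul F V)).
Local Notation mX := (thead _ (@ext_mul F V)).
Local Notation g := (gen_braid tauP).
Local Notation push := (push tauP).
Local Notation push_lm_sqr :=
  (push_sqr tauP (@ext_lmul_sqr F V)).
Lemma lXE (M : lmodType F) v x (m : M) : (i v * x) ⊗ₜ m = lX (v ⊗ₜ (x ⊗ₜ m)).
Proof. by rewrite theadE ext_lmulE. Qed.

Lemma ext_rec_uniq (M N : lmodType F) (B B' : {linear E ⊗ M -> N})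
    (A : {linear V ⊗ N -> N}) :
  (forall t, B (lX t) = A (ttail V B t)) -> (forall t, B' (lX t) = A (ttail V B' t)) ->
  (forall m, B (oneE ⊗ₜ m) = B' (oneE ⊗ₜ m)) -> B =1 B'.
Proof.
move=> BA BA' B1; apply: tens_eq => x m; elim/ext_ind_l: x => [//||v x IH].
  by elin.
by rewrite lXE BA BA' !ttailE IH.
Qed.

(** The second clause is the hexagon axiom for a product [v * x], turned into a definition. *)
Lemma braid_exists : {b : {linear E ⊗ E -> E ⊗ E} |
  (forall x, b (oneE ⊗ₜ x) = x ⊗ₜ oneE) & (forall t, b (lX t) = push lm (ttail V b t))}.
Proof.
have [b b1 bX] := ext_thead_rec push_lm_sqr (tswap E E \o tensor oneE).
by exists b => // x; rewrite b1 /= tswapE.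
Qed.
Definition braid := s2val braid_exists.
Local Notation beta := braid.

Lemma braid1 x : beta (oneE ⊗ₜ x) = x ⊗ₜ oneE.
Proof. exact: (s2valP braid_exists). Qed.

Lemma braid_lX t : beta (lX t) = push lm (ttail V beta t).
Proof. exact: (s2valP' braid_exists). Qed.

Lemma braid_incll v x : beta (i v ⊗ₜ x) = tpair idfun i (g (v ⊗ₜ x)).
Proof.
rewrite -[i v]mulr1 lXE braid_lX ttailE braid1 pushE tfrontE.
by move: (g _); tlin => y w; rewrite !tassocE ttailE tpairE ext_lmulE mulr1.
Qed.

Lemma braidr1 x : beta (x ⊗ₜ oneE) = oneE ⊗ₜ x.
Proof.
elim/ext_ind_l: x => [||v x IH]; [exact: braid1|by elin|].
by rewrite lXE braid_lX ttailE IH push1 ext_lmulE.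
Qed.

Lemma push_lm_assoc (M M0 N0 : lmodType F) (A : {linear V ⊗ M0 -> N0}) v s (m : M) :
  push (thead M A) (v ⊗ₜ tassoc (s ⊗ₜ m)) = tassoc (push A (v ⊗ₜ s) ⊗ₜ m).
Proof.
rewrite !pushE; move: s; tlin => x m0; rewrite tassocE !tfrontE.
by move: (g _); tlin => y w; rewrite !tassocE !ttailE tassocE theadE.
Qed.

Lemma tfront_braid1 (M : lmodType F) y (m : M) : tfront M beta (oneE ⊗ₜ (y ⊗ₜ m)) = y ⊗ₜ
  (oneE ⊗ₜ m).
Proof. by rewrite tfrontE braid1 tassocE. Qed.

Lemma tfront_braid_lX (M : lmodType F) (t : V ⊗ (E ⊗ (E ⊗ M))) :
  tfront M beta (lX t) = push lX (ttail V (tfront M beta) t).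
Proof.
move: t; tlin => v; tlin => x; tlin => y m.
by rewrite theadE ext_lmulE tfrontE lXE braid_lX !ttailE tfrontE push_lm_assoc.
Qed.

(** The counterpart of [push] with an element of [E] in place of the vector; a recursion by [A] for
    [B] becomes one by [push A]. *)
Lemma braid_through_exists (M N : lmodType F) (B : {linear E ⊗ M -> N}) :
  {f : {linear E ⊗ (E ⊗ M) -> E ⊗ N} | forall t, f t = ttail E B (tfront M beta t)}.
Proof. by exists (ttail E B \o tfront M beta). Qed.
Definition braid_through M N B := sval (@braid_through_exists M N B).
Local Notation thr := braid_through.
Lemma braid_throughE (M N : lmodType F) (B : {linear E ⊗ M -> N}) t :
  thr B t = ttail E B (tfront M beta t).
Proof. exact: (svalP (braid_through_exists B)). Qed.

Lemma braid_through1 (M N : lmodType F) (B : {linear E ⊗ M -> N}) y m :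
  thr B (oneE ⊗ₜ (y ⊗ₜ m)) = y ⊗ₜ B (oneE ⊗ₜ m).
Proof. by rewrite braid_throughE tfront_braid1 ttailE. Qed.

Lemma braid_through_lX (M N : lmodType F) (B : {linear E ⊗ M -> N})
    (A : {linear V ⊗ N -> N}) : (forall t, B (lX t) = A (ttail V B t)) ->
  forall t, thr B (lX t) = push A (ttail V (thr B) t).
Proof.
move=> BA t; rewrite braid_throughE tfront_braid_lX !pushE.
rewrite (@ttail_eq _ _ _ _ (thr B) (ttail E B \o tfront M beta)) => [|u];
  last exact: braid_throughE.
by rewrite -ttail_comp tfront_ttail; apply: ttail_sq.
Qed.

Lemma mul_lX (t : V ⊗ (E ⊗ E)) : mul (lX t) = lm (ttail V mul t).
Proof.
by move: t; tlin => v; tlin => x y; rewrite theadE ttailE !(ext_lmulE, ext_mulE) mulrA.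
Qed.

Lemma mX_lX (M : lmodType F) (t : V ⊗ (E ⊗ (E ⊗ M))) : mX (lX t) = lX (ttail V mX t).
Proof.
move: t; tlin => v; tlin => x; tlin => y m.
by rewrite !(theadE, ttailE) !(ext_lmulE, ext_mulE) mulrA.
Qed.

Lemma ttail_lX (X Y : lmodType F) (A : {linear X -> Y}) (t : V ⊗ (E ⊗ X)) :
  ttail E A (lX t) = lX (ttail V (ttail E A) t).
Proof. by rewrite thead_ttail. Qed.

Lemma braid_mull (t : E ⊗ (E ⊗ E)) : beta (mX t) = thr mul (ttail E beta t).
Proof.
apply: (ext_rec_uniq (B := beta \o mX) (B' := thr mul \o ttail E beta) (A := push lm)) =>
  [s|s|m].
- by rewrite /= mX_lX braid_lX !ttail_comp.
- by rewrite /= ttail_lX (braid_through_lX mul_lX) ttail_comp.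
move: m; rewrite /=; tlin => x y; rewrite theadE ext_mulE [1 * x]mul1r ttailE.
apply/esym; move: (beta _); tlin => y' x'.
by rewrite braid_through1 ext_mulE mul1r.
Qed.

Lemma braid_mulr (t : E ⊗ (E ⊗ E)) : beta (ttail E mul t) = mX (thr beta t).
Proof.
apply: (ext_rec_uniq (B := beta \o ttail E mul) (B' := mX \o thr beta) (A := push lm)) =>
  [s|s|m].
- by rewrite /= ttail_lX braid_lX ttail_comp.
- by rewrite /= (braid_through_lX braid_lX) mX_push_push ttail_comp.
move: m; rewrite /=; tlin => x y.
by rewrite ttailE braid_through1 !braid1 theadE !ext_mulE.
Qed.

(** The Yang-Baxter equation for [beta] with one strand a vector that passes the other two. *)
Lemma push_push_braid (M N : lmodType F) (A : {linear V ⊗ M -> N}) t :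
  tfront N beta (push (push A) t) = push (push A) (ttail V (tfront M beta) t).
Proof.
apply: (@push_equivariance _ _ _ _ _ _ _ _ _ _ _ _ (push lX) (push lX)) => [s|s||v m].
- exact: tfront_braid_lX.
- exact: tfront_braid_lX.
- by apply/tau_equivariant_push/tau_equivariant_lX.
(* Braiding a unit past [x] merely inserts it behind [x], so the base case compares two ways of
   inserting a unit. *)
have unE (M' : lmodType F) (s : E ⊗ M') : tfront M' beta (oneE ⊗ₜ s) = ttail E (tensor oneE) s.
  by move: s; tlin => x m'; rewrite tfront_braid1 ttailE.
rewrite !unE.
have -> : v ⊗ₜ ttail E (tensor oneE) m = ttail V (ttail E (tensor oneE)) (v ⊗ₜ m) by rewrite
  ttailE.
rewrite push_ttail ttail_push.
by apply: push_eq => {v m}; apply: tens_eq => v m; rewrite /= ttailE push1.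
Qed.

Lemma braid_ybe (t : E ⊗ (E ⊗ E)) :
  tfront E beta (ttail E beta (tfront E beta t)) = ttail E beta (tfront E beta (ttail E beta
    t)).
Proof.
rewrite -!braid_throughE.
apply: (ext_rec_uniq (B := tfront E beta \o thr beta) (B' := thr beta \o ttail E beta)
  (A := push (push lm))) => [s|s|m] /=.
- by rewrite (braid_through_lX braid_lX) push_push_braid ttail_comp.
- by rewrite ttail_lX (braid_through_lX braid_lX) ttail_comp.
move: m; tlin => y z; rewrite braid_through1 braid1 tfrontE ttailE.
by move: (beta _); tlin => z' y'; rewrite braid_through1 braid1 tassocE.
Qed.
End Braiding.

(** * Coproduct and counit *)

Section HopfStructure.
Variables (F : fieldType) (V : lmodType F).
Variables (tau : {linear V ⊗ V -> V ⊗ V}) (tauP : exterior_braiding tau).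

Local Notation E := (ext V : lmodType F).
Local Notation oneE := (1 : ext V).
Local Notation i := (@ext_inc F V).
Local Notation mul := (@ext_mul F V).
Local Notation lm := (@ext_lmul F V).
Local Notation lX := (thead _ (@ext_lmul F V)).
Local Notation mX := (thead _ (@ext_mul F V)).
Local Notation push := (push tauP).
Local Notation twist := (twist tauP).
Local Notation beta := (braid tauP).
Local Notation thr := (braid_through tauP).

(** [twist lm] is left multiplication by [v ⊗ 1 + 1 ⊗ v] in the braided tensor square, so the
    recursion imposes multiplicativity with [v] primitive. *)
Lemma comul_exists : {D : {linear E -> E ⊗ E} |
  D 1 = oneE ⊗ₜ oneE & forall t, D (lm t) = twist lm (ttail V D t)}.
Proof.
exact: (ext_rec (twist_sqr tauP (@ext_lmul_sqr F V))).
Qed.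
Definition comul := s2val comul_exists.
Local Notation D := comul.
Lemma comul1 : D 1 = oneE ⊗ₜ oneE.
Proof. exact: (s2valP comul_exists). Qed.
Lemma comul_lm t : D (lm t) = twist lm (ttail V D t).
Proof. exact: (s2valP' comul_exists). Qed.

Lemma comul_incl v : D (i v) = i v ⊗ₜ oneE + oneE ⊗ₜ i v.
Proof.
rewrite -[i v]mulr1 -ext_lmulE comul_lm ttailE comul1 twistE push1 theadE.
by rewrite !ext_lmulE mulr1.
Qed.

Lemma comulX_exists (M : lmodType F) :
  {f : {linear E ⊗ M -> E ⊗ (E ⊗ M)} | forall x m, f (x ⊗ₜ m) = tassoc (D x ⊗ₜ m)}.
Proof. by exists (tassoc \o tmap D idfun) => x m /=; rewrite tmapE. Qed.
Definition comul_thead M := sval (comulX_exists M).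
Local Notation DX := comul_thead.
Lemma comul_theadE (M : lmodType F) x (m : M) : DX M (x ⊗ₜ m) = tassoc (D x ⊗ₜ m).
Proof. exact: (svalP (comulX_exists M)). Qed.

Lemma thead_assoc (X Y W Z M : lmodType F) (A : {linear X ⊗ Y -> W}) x (s : Y ⊗ Z) (m : M) :
  thead _ A (x ⊗ₜ tassoc (s ⊗ₜ m)) = tassoc (thead Z A (x ⊗ₜ s) ⊗ₜ m).
Proof. by move: s; tlin => y z; rewrite tassocE !theadE tassocE. Qed.

Lemma comul_thead_lX (M : lmodType F) (t : V ⊗ (E ⊗ M)) :
  DX M (lX t) = twist lX (ttail V (DX M) t).
Proof.
move: t; tlin => v; tlin => x m.
rewrite theadE ttailE !comul_theadE comul_lm ttailE !twistE.
by rewrite thead_assoc push_lm_assoc tensorDl linearD.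
Qed.

Lemma comul_hd1 (M : lmodType F) (m : M) : DX M (oneE ⊗ₜ m) = oneE ⊗ₜ (oneE ⊗ₜ m).
Proof. by rewrite comul_theadE comul1 tassocE. Qed.

(** Compatibility of coproduct and braiding when one strand is a vector; it feeds both
    [braid_comull] and coassociativity. *)
Lemma comul_thead_push (M N : lmodType F) (A : {linear V ⊗ M -> N}) t :
  DX N (push A t) = push (push A) (ttail V (DX M) t).
Proof.
apply: (@push_equivariance _ _ _ _ _ _ _ _ _ _ _ _ (twist lX) (twist lX)) => [s|s||v m].
- exact: comul_thead_lX.
- exact: comul_thead_lX.
- apply: tau_equivariant_twist; first exact: tau_equivariant_lX.
  exact/tau_equivariant_push/tau_equivariant_lX.
- by rewrite !comul_hd1 !push1.
Qed.

Lemma braid_comull t : DX E (beta t) = thr beta (ttail E D t).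
Proof.
apply: (ext_rec_uniq (B := DX E \o beta) (B' := thr beta \o ttail E D)
  (A := push (push lm))) => [s|s|x] /=.
- by rewrite braid_lX comul_thead_push ttail_comp.
- by rewrite ttail_lX (braid_through_lX tauP (braid_lX tauP)) ttail_comp.
rewrite braid1 ttailE comul_theadE; move: (D x); tlin => y z.
by rewrite braid_through1 braid1 tassocE.
Qed.

Lemma ttail_twist (M N : lmodType F) (A : {linear V ⊗ M -> M}) (B : {linear V ⊗ N -> N})
    (f : {linear M -> N}) : (forall t, f (A t) = B (ttail V f t)) ->
  forall t, ttail E f (twist A t) = twist B (ttail V (ttail E f) t).
Proof.
move=> fA t; rewrite !twistE linearD ttail_lX ttail_push push_ttail; congr (_ + _).
exact: push_eq.
Qed.

Lemma comul_coassoc x : DX E (D x) = ttail E D (D x).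
Proof.
elim/ext_ind_l: x => [|a x y IHx IHy|v x IH]; last 1 first.
(* Both sides become a sum of three insertions of [v], one into each tensor factor. *)
- rewrite -ext_lmulE comul_lm (ttail_twist comul_lm) twistE linearD !ttailE.
  rewrite comul_thead_lX comul_thead_push !ttailE !twistE /= -IH -addrA; congr (_ + _).
  by rewrite push_twist.
- by rewrite comul1 comul_hd1 ttailE comul1.
- by rewrite !linearP /= IHx IHy.
Qed.

Lemma ttail_braid_twist (M N : lmodType F) (B : {linear E ⊗ M -> N})
    (A : {linear V ⊗ N -> N}) : (forall t, B (lX t) = A (ttail V B t)) ->
  forall t, ttail E (thr B) (twist lX t) = twist (push A) (ttail V (ttail E (thr B)) t).
Proof. by move=> BA t; apply/ttail_twist/braid_through_lX. Qed.

Lemma braid_comulr t : ttail E D (beta t) = tfront E beta (ttail E beta (DX E t)).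
Proof.
apply: (ext_rec_uniq (B := ttail E D \o beta) (B' := tfront E beta \o ttail E beta \o DX E)
  (A := push (twist lm))) => [s|s|x] /=.
- rewrite braid_lX ttail_push -ttail_comp push_ttail.
  by apply: push_eq => u; rewrite /= comul_lm.
- rewrite comul_thead_lX (ttail_twist (braid_lX tauP)) twistE linearD.
  rewrite tfront_braid_lX push_push_braid !ttail_comp.
  by rewrite push_twist.
by rewrite braid1 ttailE comul1 comul_hd1 ttailE braid1 tfront_braid1.
Qed.

(** The right-hand side is the product of [D x] and [D y] in the braided tensor square. Both sides
    are recursive in [x] with step [twist lm]. *)
Lemma comul_mul x y : D (x * y) = mX (ttail E (thr mul) (DX _ (x ⊗ₜ D y))).
Proof.
rewrite -ext_mulE -[x ⊗ₜ D y]ttailE.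
apply: (ext_rec_uniq (B := D \o mul)
  (B' := mX \o ttail E (thr mul) \o DX (E ⊗ E) \o ttail E D)
  (A := twist lm)) => [s|s|x'] /=.
- by rewrite mul_lX comul_lm ttail_comp.
- rewrite ttail_lX comul_thead_lX (ttail_braid_twist (@mul_lX _ _)) twistE linearD.
  by rewrite mX_lX mX_push_push !ttail_comp -twistE.
rewrite ext_mulE mul1r ttailE comul_hd1 ttailE; apply/esym.
move: (D x'); tlin => a b.
by rewrite braid_through1 theadE !ext_mulE !mul1r.
Qed.

Lemma counit_exists : {eps : {linear E -> F^o} |
  eps 1 = 1 & forall t, eps (lm t) = 0}.
Proof.
have [eps eps1 epsM] := @ext_rec _ V F^o \0 (fun _ _ => erefl) 1.
by exists eps.
Qed.
Definition counit := s2val counit_exists.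
Local Notation eps := counit.
Lemma counit1 : eps 1 = 1.
Proof. exact: (s2valP counit_exists). Qed.
Lemma counit_lm t : eps (lm t) = 0.
Proof. exact: (s2valP' counit_exists). Qed.

Lemma counitl_exists (M : lmodType F) :
  {f : {linear E ⊗ M -> M} | forall x m, f (x ⊗ₜ m) = eps x *: m}.
Proof. by exists (tlunit \o tmap eps idfun) => x m; rewrite /= tmapE tlunitE. Qed.
Definition counitl M := sval (counitl_exists M).
Lemma counitlE (M : lmodType F) x (m : M) : counitl M (x ⊗ₜ m) = eps x *: m.
Proof. exact: (svalP (counitl_exists M)). Qed.

Lemma counitr_exists (M : lmodType F) :
  {f : {linear M ⊗ E -> M} | forall m x, f (m ⊗ₜ x) = eps x *: m}.
Proof. by exists (trunit \o tmap idfun eps) => m x; rewrite /= tmapE trunitE. Qed.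
Definition counitr M := sval (counitr_exists M).
Lemma counitrE (M : lmodType F) (m : M) x : counitr M (m ⊗ₜ x) = eps x *: m.
Proof. exact: (svalP (counitr_exists M)). Qed.

Lemma counitl_lX (M : lmodType F) (t : V ⊗ (E ⊗ M)) : counitl M (lX t) = 0.
Proof.
by move: t; tlin => v; tlin => x m; rewrite theadE counitlE counit_lm scale0r.
Qed.

Lemma counitl_push (M N : lmodType F) (A : {linear V ⊗ M -> N}) t :
  counitl N (push A t) = A (ttail V (counitl M) t).
Proof.
apply: (@push_equivariance _ _ _ _ _ _ _ _ _ _ _ _ \0 \0) => [s|s|s|v m].
- exact: counitl_lX.
- exact: counitl_lX.
- rewrite (_ : ttail V \0 s = 0) ?linear0 //.
  by move: s; tlin => v m; rewrite ttailE linear0.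
- by rewrite !counitlE counit1 !scale1r.
Qed.

Lemma counitr_push (M : lmodType F) (t : V ⊗ (E ⊗ E)) : counitr E (push lm t) = 0.
Proof.
rewrite pushE; move: (tfront _ _ _); tlin => x u.
by rewrite ttailE counitrE counit_lm scale0r.
Qed.

Lemma counitr_lX (t : V ⊗ (E ⊗ E)) : counitr E (lX t) = lm (ttail V (counitr E) t).
Proof.
move: t; tlin => v; tlin => x y.
by rewrite theadE ttailE !counitrE !ext_lmulE scalerAr.
Qed.

Lemma comul_counitl x : counitl E (D x) = x.
Proof.
elim/ext_ind_l: x => [|a x y IHx IHy|v x IH]; last 1 first.
- rewrite -ext_lmulE comul_lm twistE linearD counitl_lX counitl_push.
  by rewrite add0r !ttailE IH.
- by rewrite comul1 counitlE counit1 scale1r.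
- by rewrite !linearP /= IHx IHy.
Qed.

Lemma comul_counitr x : counitr E (D x) = x.
Proof.
elim/ext_ind_l: x => [|a x y IHx IHy|v x IH]; last 1 first.
- rewrite -ext_lmulE comul_lm twistE linearD counitr_lX counitr_push //.
  by rewrite addr0 !ttailE IH.
- by rewrite comul1 counitrE counit1 scale1r.
- by rewrite !linearP /= IHx IHy.
Qed.

Lemma braid_counitl t : counitl E (beta t) = counitr E t.
Proof.
apply: (ext_rec_uniq (B := counitl E \o beta) (B' := counitr E) (A := lm)) => [s|s|x] /=.
- by rewrite braid_lX counitl_push ttail_comp.
- exact: counitr_lX.
by rewrite braid1 counitlE counitrE.
Qed.

Lemma braid_counitr t : counitr E (beta t) = counitl E t.
Proof.
apply: (ext_rec_uniq (B := counitr E \o beta) (B' := counitl E) (A := \0)) => [s|s|x] /=.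
- by rewrite braid_lX counitr_push.
- exact: counitl_lX.
by rewrite braid1 counitlE counitrE.
Qed.
End HopfStructure.

(** * Antipode *)

Section Antipode.
Variables (F : fieldType) (p : F) (V : lmodType F).
Variables (tau : {linear V ⊗ V -> V ⊗ V}) (tauP : exterior_braiding tau).
Hypothesis mul_tau : forall v w : V,
  ext_mul V (tpair (ext_inc V) (ext_inc V) (tau (v ⊗ₜ w)))
    = p *: (ext_inc V v * ext_inc V w).

Local Notation E := (ext V : lmodType F).
Local Notation i := (@ext_inc F V).
Local Notation mul := (@ext_mul F V).
Local Notation lm := (@ext_lmul F V).
Local Notation rm := (@ext_rmul F V).
Local Notation lX := (thead _ (@ext_lmul F V)).
Local Notation g := (gen_braid tauP).
Local Notation push := (push tauP).
Local Notation twist := (twist tauP).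
Local Notation beta := (braid tauP).
Local Notation D := (comul tauP).
Local Notation eps := (@counit F V).

(* Multiplication by p^n in degree n. *)
Lemma grading_exists : {f : {linear E -> E} |
  f 1 = 1 & forall t, f (lm t) = p *: lm (ttail V f t)}.
Proof.
have sq v x : (p \*: lm) (v ⊗ₜ (p \*: lm) (v ⊗ₜ x)) = 0.
  by rewrite /= tensorZr linearZZ ext_lmul_sqr !scaler0.
exact: ext_rec sq 1.
Qed.
Definition grading := s2val grading_exists.
Local Notation theta := grading.
Lemma grading1 : theta 1 = 1.
Proof. exact: (s2valP grading_exists). Qed.
Lemma grading_lm t : theta (lm t) = p *: lm (ttail V theta t).
Proof. exact: (s2valP' grading_exists). Qed.

Lemma gradingM x y : theta (x * y) = theta x * theta y.
Proof.
elim/ext_ind_l: x => [|a x x' IH IH'|v x IH].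
- by rewrite grading1 !mul1r.
- by rewrite mulrDl -scalerAl !linearP /= IH IH' mulrDl -scalerAl.
- rewrite -mulrA -!ext_lmulE !grading_lm !ttailE !ext_lmulE IH mulrA.
  by rewrite -scalerAl.
Qed.

Lemma grading_incl v : theta (i v) = p *: i v.
Proof.
by rewrite -[i v]mulr1 -ext_lmulE grading_lm ttailE grading1.
Qed.

(** Each vector of [x] that [v] passes contributes one factor [p], by [mul_tau]. *)
Lemma rmul_gen_braid v x : rm (g (v ⊗ₜ x)) = i v * theta x.
Proof.
elim/ext_ind_r: x => [|a x y IHx IHy|x w IH].
- by rewrite gen_braid1 ext_rmulE grading1 mulr1 mul1r.
- by rewrite tensor_linearr !linearP /= IHx IHy mulrDr -scalerAr.
rewrite gen_braidMr gradingM grading_incl -!scalerAr mulrA -IH.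
move: (g _); tlin => [y u|]; last by rewrite mulrDl scalerDr.
rewrite tassocE ttailE ext_rmulE -mulrA scalerAr -mul_tau.
move: (tau _); tlin => [u' w'|]; last by rewrite mulrDr.
by rewrite theadE tpairE ext_mulE !ext_rmulE mulrA.
Qed.

(** An antipode must be braided anti-multiplicative, [S (v * x) = mul (beta (S v ⊗ S x))], with
    [S v = - v]; by [rmul_gen_braid] this becomes the stated recursion. *)
Lemma antipode_exists : {S : {linear E -> E} |
  S 1 = 1 & forall t, S (lm t) = - lm (ttail V theta (ttail V S t))}.
Proof.
have sq v x : (\- (lm \o ttail V theta)) (v ⊗ₜ (\- (lm \o ttail V theta)) (v ⊗ₜ x)) = 0.
  rewrite /= !ttailE linearN grading_lm ttailE linearN /= linearN opprK.
  by rewrite tensorZr linearZZ ext_lmul_sqr scaler0.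
have [S S1 SM] := ext_rec sq 1.
by exists S.
Qed.
Definition antipode := s2val antipode_exists.
Local Notation S := antipode.
Lemma antipode1 : S 1 = 1.
Proof. exact: (s2valP antipode_exists). Qed.
Lemma antipode_lm t : S (lm t) = - lm (ttail V theta (ttail V S t)).
Proof. exact: (s2valP' antipode_exists). Qed.

Lemma tfst_exists (M : lmodType F) (f : {linear E -> E}) :
  {h : {linear E ⊗ M -> E ⊗ M} | forall x m, h (x ⊗ₜ m) = f x ⊗ₜ m}.
Proof. by exists (tmap f idfun) => x m; rewrite /= tmapE. Qed.
Definition tfst M f := sval (tfst_exists M f).
Lemma tfstE (M : lmodType F) (f : {linear E -> E}) x (m : M) :
  tfst M f (x ⊗ₜ m) = f x ⊗ₜ m.
Proof. exact: (svalP (tfst_exists M f)). Qed.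

(** * Degreewise scalings commute with the braiding *)

Section Scaling.
Variables (c : F) (h f : {linear E -> E}).
Hypothesis f1 : f 1 = 1.
Hypothesis f_lm : forall t, f (lm t) = c *: lm (ttail V h (ttail V f t)).

Lemma tfst_lX M t : tfst M f (lX t) = c *: lX (ttail V (tfst M h) (ttail V (tfst M f) t)).
Proof.
move: t; tlin => [v|]; last by rewrite scalerDr.
tlin => [x m|]; last by rewrite scalerDr.
by rewrite theadE tfstE f_lm !ttailE !tfstE theadE tensorZl.
Qed.

(** The shape of [f_lm] covers [theta], with [c = p] and [h] the identity, and then [S], with
    [c = -1] and [h = theta]; the first case supplies the assumption on [h] for the second. *)
Lemma tfst_push :
  (forall (M N : lmodType F) (A : {linear V ⊗ M -> N}) t,
     tfst N h (push A t) = push A (ttail V (tfst M h) t)) ->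
  forall (M N : lmodType F) (A : {linear V ⊗ M -> N}) t,
  tfst N f (push A t) = push A (ttail V (tfst M f) t).
Proof.
move=> hA M N A.
apply: (@push_equivariance _ _ _ _ _ _ _ _ _ _ _ _
  (c \*: (lX \o ttail V (tfst M h))) (c \*: (lX \o ttail V (tfst N h)))) => [s|s|s|v m].
- exact: tfst_lX.
- exact: tfst_lX.
- have -> : ttail V (c \*: (lX \o ttail V (tfst M h))) s
      = c *: ttail V lX (ttail V (ttail V (tfst M h)) s).
    rewrite ttail_comp; move: s; tlin => [v u|]; last by rewrite scalerDr.
    by rewrite !ttailE /= tensorZr.
  rewrite linearZZ tau_equivariant_lX tfront_ttail /=; congr (_ *: lX _).
  by apply: ttail_sq => u; rewrite hA.
- by rewrite !tfstE f1 push1.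
Qed.

Lemma braid_tfst : (forall t, beta (tfst E h t) = ttail E h (beta t)) ->
  forall t, beta (tfst E f t) = ttail E f (beta t).
Proof.
move=> hbeta.
apply: (ext_rec_uniq (B := beta \o tfst E f) (B' := ttail E f \o beta)
  (A := c \*: (push lm \o ttail V (ttail E h)))) => [s|s|x] /=.
- rewrite tfst_lX linearZZ braid_lX; congr (_ *: push _ _).
  by rewrite (ttail_sq (A' := beta) (B' := ttail E h)) // !ttail_comp; apply: ttail_eq.
- rewrite braid_lX ttail_push -(ttail_comp beta (ttail E f)) !push_ttail -pushZ.
  exact: push_eq.
- by rewrite tfstE f1 !braid1 ttailE f1.
Qed.

Lemma braid_ttail : 
  (forall (M N : lmodType F) (A : {linear V ⊗ M -> N}) t,
     tfst N f (push A t) = push A (ttail V (tfst M f) t)) ->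
  forall t, beta (ttail E f t) = tfst E f (beta t).
Proof.
move=> fA.
apply: (ext_rec_uniq (B := beta \o ttail E f) (B' := tfst E f \o beta)
  (A := push lm)) => [s|s|x] /=.
- by rewrite ttail_lX braid_lX ttail_comp.
- by rewrite braid_lX fA ttail_comp.
- by rewrite ttailE !braid1 tfstE.
Qed.
End Scaling.

Lemma tfst_id (M : lmodType F) : tfst M idfun =1 idfun.
Proof. by tlin => x m; rewrite tfstE. Qed.

Lemma grading_lm_id t : theta (lm t) = p *: lm (ttail V idfun (ttail V theta t)).
Proof. by rewrite grading_lm [ttail V idfun _]ttail_id. Qed.

Lemma antipode_lm_theta t : S (lm t) = (-1) *: lm (ttail V theta (ttail V S t)).
Proof. by rewrite antipode_lm scaleN1r. Qed.

Lemma tfst_grading_push (M N : lmodType F) (A : {linear V ⊗ M -> N}) t :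
  tfst N theta (push A t) = push A (ttail V (tfst M theta) t).
Proof.
apply: (tfst_push grading1 grading_lm_id) => M' N' B s.
by rewrite tfst_id [ttail V _ s]ttail_id //; exact: tfst_id.
Qed.

Lemma tfst_antipode_push (M N : lmodType F) (A : {linear V ⊗ M -> N}) t :
  tfst N S (push A t) = push A (ttail V (tfst M S) t).
Proof. exact: (tfst_push antipode1 antipode_lm_theta tfst_grading_push). Qed.

Lemma braid_antipodel t : beta (tfst E S t) = ttail E S (beta t).
Proof.
apply: (braid_tfst antipode1 antipode_lm_theta) => {}t.
by apply: (braid_tfst grading1 grading_lm_id) => {}t; rewrite tfst_id ttail_id.
Qed.

Lemma braid_antipoder t : beta (ttail E S t) = tfst E S (beta t).
Proof. exact: (braid_ttail tfst_antipode_push). Qed.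

Lemma mul_push_lm v a b : mul (push lm (v ⊗ₜ (a ⊗ₜ b))) = i v * theta a * b.
Proof.
rewrite pushE tfrontE -rmul_gen_braid.
move: (g _); tlin => [x w|]; last by rewrite mulrDl.
by rewrite tassocE ttailE ext_mulE ext_lmulE ext_rmulE mulrA.
Qed.

Lemma comul_antipoder x : mul (ttail E S (D x)) = eps x *: 1.
Proof.
elim/ext_ind_l: x => [|a x y IHx IHy|v x IH].
- by rewrite comul1 ttailE ext_mulE antipode1 mulr1 counit1 scale1r.
- by rewrite !linearP /= IHx IHy scalerDl scalerA.
(* The pushed vector meets [S (w * b) = - w * theta (S b)], which gives the term with [theta]. By
   induction the product is a multiple of [1], fixed by [theta], so the difference vanishes. *)
have key s : mul (ttail E S (twist lm (v ⊗ₜ s)))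
    = i v * (mul (ttail E S s) - theta (mul (ttail E S s))).
  rewrite twistE !linearD ttail_lX mul_lX !ttailE ext_lmulE mulrBr /=; congr (_ + _).
  move: s; tlin => [a b|]; last by rewrite mulrDr opprD.
  rewrite ttail_push pushE tfrontE ttailE ext_mulE gradingM mulrA -rmul_gen_braid.
  move: (g _); tlin => [y w|]; last by rewrite mulrDl opprD.
  rewrite tassocE ttailE ext_rmulE ext_mulE /= antipode_lm !ttailE ext_lmulE.
  by rewrite mulrN mulrA.
rewrite -ext_lmulE comul_lm ttailE key IH counit_lm linearZZ grading1.
by rewrite subrr mulr0 scale0r.
Qed.

Lemma comul_antipodel x : mul (tfst E S (D x)) = eps x *: 1.
Proof.
elim/ext_ind_l: x => [|a x y IHx IHy|v x IH].
- by rewrite comul1 tfstE ext_mulE antipode1 mulr1 counit1 scale1r.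
- by rewrite !linearP /= IHx IHy scalerDl scalerA.
rewrite -ext_lmulE comul_lm ttailE counit_lm scale0r.
(* The cancellation takes place on each term [a ⊗ b]: [S (v * a) * b] is opposite to the
   contribution of the pushed vector. *)
move: (D x); tlin => a b.
rewrite twistE !linearD tfst_antipode_push theadE ttailE !tfstE mul_push_lm ext_mulE.
by rewrite antipode_lm !ttailE ext_lmulE mulNr addNr.
Qed.
End Antipode.

(** * The inverse braiding *)

Section Inverse.
Variables (F : fieldType) (V : lmodType F).
Variables tau sigma : {linear V ⊗ V -> V ⊗ V}.
Hypotheses (tauP : exterior_braiding tau) (sigmaP : exterior_braiding sigma).
Hypothesis sigmaK : cancel sigma tau.

Local Notation E := (ext V : lmodType F).
Local Notation i := (@ext_inc F V).
Local Notation mul := (@ext_mul F V).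
Local Notation lX := (thead _ (@ext_lmul F V)).
Local Notation rX := (thead _ (@ext_rmul F V)).
Local Notation mX := (thead _ (@ext_mul F V)).
Local Notation beta := (braid tauP).
Local Notation thr := (braid_through tauP).
Local Notation g' := (gen_braid sigmaP).
Local Notation beta' := (braid sigmaP).

Lemma braid_incl t : beta (tpair i i t) = tpair i i (tau t).
Proof.
move: t; tlin => v w; rewrite tpairE braid_incll gen_braidE.
by move: (tau _); tlin => v' w'; rewrite !tpairE.
Qed.

(** For each vector of [x], [g'] applies one [sigma], and [beta] undoes it: by [braid_mull] it acts
    on the two vectors involved through [tau]. *)
Lemma braid_gen_braidV v x : beta (ttail E i (g' (v ⊗ₜ x))) = i v ⊗ₜ x.
Proof.
elim/ext_ind_r: x => [||x w IH]; [|by elin|].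
  rewrite gen_braid1 ttailE braid1 //.
have key (t : E ⊗ V) : beta (ttail E i (rX (ttail E sigma (tassoc (t ⊗ₜ w)))))
    = ttail E mul (tassoc (beta (ttail E i t) ⊗ₜ i w)).
  move: t; tlin => y u; rewrite tassocE !ttailE.
  have -> : beta (ttail E i (rX (y ⊗ₜ sigma (u ⊗ₜ w))))
      = thr mul (y ⊗ₜ tpair i i (tau (sigma (u ⊗ₜ w)))).
    move: (sigma _); tlin => u' w'.
    have := braid_mull tauP (y ⊗ₜ (i u' ⊗ₜ i w')).
    rewrite -braid_incl tpairE ttailE => <-; by rewrite !theadE ext_rmulE ttailE ext_mulE.
  by rewrite sigmaK tpairE braid_throughE tfrontE.
by rewrite gen_braidMr key IH tassocE ttailE ext_mulE.
Qed.

(** The other cancellation is the instance with [tau] and [sigma] exchanged. *)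
Lemma braidVK : cancel beta' beta.
Proof.
have key v s : beta (push sigmaP (ext_lmul V) (v ⊗ₜ s)) = lX (v ⊗ₜ beta s).
  move: s; tlin => x y; rewrite pushE tfrontE.
  have gkey (t : E ⊗ V) : beta (ttail E (ext_lmul V) (tassoc (t ⊗ₜ y)))
      = mX (ttail E beta (tassoc (beta (ttail E i t) ⊗ₜ y))).
    move: t; tlin => x' v'; rewrite tassocE !ttailE ext_lmulE.
    have := braid_mulr tauP (x' ⊗ₜ (i v' ⊗ₜ y)).
    by rewrite ttailE ext_mulE braid_throughE tfrontE.
  rewrite gkey braid_gen_braidV tassocE ttailE.
  by move: (beta _); tlin => x' y'; rewrite !theadE ext_mulE ext_lmulE.
apply: (ext_rec_uniq (B := beta \o beta') (B' := idfun) (A := lX)) => [t|t|x] /=.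
- rewrite braid_lX -ttail_comp; move: (ttail V beta' t); tlin => v s.
  by rewrite key ttailE.
- by rewrite ttail_id.
- by rewrite braid1 braidr1.
Qed.
End Inverse.

(** * The braiding on a basis *)

Section Basis.
Variables (F : fieldType) (V : lmodType F) (I : choiceType) (b : I -> V).
Hypothesis hb : is_basis b.

Lemma basis_ind (P : V -> Prop) : P 0 ->
  (forall a x y, P x -> P y -> P (a *: x + y)) ->
  (forall i, P (b i)) -> forall v, P v.
Proof.
by move=> P0 PZD Pb v; elim: (hb.2 v) => // a x y [i ->] _; exact: PZD.
Qed.

Lemma basis_coord : {c : {linear V -> {malg F[I]}} | forall i, c (b i) = << i >>}.
Proof.
(* The two halves of [is_basis] make [free_lift b] bijective; [c] is its inverse. *)
have [span free] : (forall v, exists m, free_lift b m = v) /\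
    injective (free_lift b : {malg F[I]} -> V).
  split=> [v|m m' /eqP].
    elim: (hb.2 v) => [|a x y [i ->] _ [m <-]]; first by exists 0; rewrite linear0.
    by exists (a *: << i >> + m); rewrite free_liftP free_liftU.
  rewrite -subr_eq0 -linearB => /eqP m0; apply/eqP; rewrite -subr_eq0; apply/eqP.
  have [indep _] := hb.
  apply/malgP => k; rewrite mcoeff0.
  have [km|km] := boolP (k \in msupp (m - m')); last by rewrite mcoeff_outdom.
  exact: (indep _ (fun k => (m - m')@_k) (fset_uniq _) m0 _ km).
pose c v := projT1 (cid (span v)).
have cE m : c (free_lift b m) = m by rewrite /c; case: cid => m' /= /free.
have c_lin : linear c.
  move=> a x y; have [m <-] := span x; have [m' <-] := span y.
  by rewrite -free_liftP !cE.
exists (HB.pack c (GRing.isLinear.Build F V {malg F[I]} *:%R c c_lin) :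
  {linear V -> {malg F[I]}}) => i /=.
by rewrite -[b i](free_liftU b) cE.
Qed.

Lemma basis_bilinear (N : lmodType F) (f : I -> I -> N) :
  {g : {linear V ⊗ V -> N} | forall i j, g (b i ⊗ₜ b j) = f i j}.
Proof.
have [c cE] := basis_coord.
pose h v w := free_lift (fun i => free_lift (f i) (c w)) (c v).
have hl w : linear (h^~ w) by move=> a x y; rewrite /h linearP free_liftP.
have hr v : linear (h v).
  move=> a x y; rewrite /h /free_lift scaler_sumr -big_split /=.
  apply: eq_bigr => k _; rewrite -!/(free_lift _ _) linearP free_liftP.
  by rewrite scalerDr !scalerA mulrC.
by exists (tens_lift hl hr) => i j; rewrite tens_liftE /h !cE !free_liftU.
Qed.

Lemma basis_tens_ind (P : V ⊗ V -> Prop) : P 0 ->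
  (forall a x y, P x -> P y -> P (a *: x + y)) ->
  (forall i j, P (b i ⊗ₜ b j)) -> forall t, P t.
Proof.
move=> P0 PZD Pb; have pure v w : P (v ⊗ₜ w).
  elim/basis_ind: v => [|a x y Px Py|i]; first by rewrite tensor0l.
    by rewrite tensor_linearl; apply: PZD.
  elim/basis_ind: w => [|a x y Px Py|j]; [by rewrite tensor0r| |exact: Pb].
  by rewrite tensor_linearr; apply: PZD.
apply: tens_ind => // x y Px Py.
by rewrite -[x]scale1r; apply: PZD.
Qed.

Lemma basis_tens_eq (N : lmodType F) (f g : {linear V ⊗ V -> N}) :
  (forall i j, f (b i ⊗ₜ b j) = g (b i ⊗ₜ b j)) -> f =1 g.
Proof.
move=> fg; elim/basis_tens_ind => [|a x y fx fy|//]; first by rewrite !linear0.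
by rewrite !linearP fx fy.
Qed.
End Basis.

Section BasisBraiding.
Variables (F : fieldType) (p : F) (V : lmodType F).
Variables (d : Order.disp_t) (I : orderType d) (b : I -> V).
Hypothesis hb : is_basis b.
Variable tau : {linear V ⊗ V -> V ⊗ V}.
Hypothesis htau : forall i j : I, tau (b i ⊗ₜ b j) =
  if i == j then - (b i ⊗ₜ b i)
  else if (j < i)%O then - ((1 - p) *: (b i ⊗ₜ b j)) - b j ⊗ₜ b i
  else - (p *: (b j ⊗ₜ b i)).

(* On the diagonal the split of [-1] between the two coefficients is free;
   with [(-1, 0)] the Yang-Baxter equation holds coefficientwise. *)
Let al1 (i j : I) : F := if i == j then -1 else if (j < i)%O then p - 1 else 0.
Let be1 (i j : I) : F := if i == j then 0 else if (j < i)%O then -1 else - p.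

Let tauE i j : tau (b i ⊗ₜ b j)
  = al1 i j *: (b i ⊗ₜ b j) + be1 i j *: (b j ⊗ₜ b i).
Proof.
rewrite htau /al1 /be1; case: eqVneq => [->|_].
  by rewrite scaleN1r scale0r addr0.
case: ifP => _; first by rewrite -scaleNr opprB scaleN1r.
by rewrite scale0r add0r scaleNr.
Qed.

(** Coefficients of the tensors indexed by [ijk], [jik] and [ikj] in the Yang-Baxter equation on
    [b i ⊗ (b j ⊗ b k)]; those of the other three permutations agree by commutativity of [F]. *)
Let coef_ybe i j k :
  [/\ al1 i j * al1 j k * al1 i j + be1 i j * al1 i k * be1 j i
        = al1 j k * al1 i j * al1 j k + be1 j k * al1 i k * be1 k j,
      al1 i j * al1 j k * be1 i j + be1 i j * al1 i k * al1 j i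
        = al1 j k * be1 i j * al1 i k
    & al1 i j * be1 j k * al1 i k
        = al1 j k * al1 i j * be1 j k + be1 j k * al1 i k * al1 k j].
Proof.
rewrite /al1 /be1.
have [ij|ij|->] := ltgtP i j; have [jk|jk|jk] := ltgtP j k; rewrite ?eqxx.
- by have ik := lt_trans ij jk; rewrite (lt_eqF ik) (lt_gtF ik); split; ring.
- by case: (ltgtP i k) => _; split; ring.
- by rewrite -jk (lt_eqF ij) (lt_gtF ij); split; ring.
- by case: (ltgtP i k) => _; split; ring.
- by have ki := lt_trans jk ij; rewrite (gt_eqF ki) ki; split; ring.
- by rewrite -jk (gt_eqF ij) ij; split; ring.
- by split; ring.
- by split; ring.
- by split; ring.
Qed.

(** Each side expands into eight terms; [x1] to [x6] stand for the tensors [ijk], [jik], [ikj],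
    [kij], [jki], [kji]. *)
Let ybe_terms (M : lmodType F) (c1 c2 c3 c4 c5 c6 c7 c8 d1 d2 d3 d4 d5 d6 d7 d8 : F)
    (x1 x2 x3 x4 x5 x6 : M) :
  c1 + c6 = d1 + d6 -> c2 + c5 = d3 -> c3 = d2 + d5 -> c4 = d7 -> c7 = d4 -> c8 = d8 ->
  ((c1 *: x1 + c2 *: x2) + (c3 *: x3 + c4 *: x4))
    + ((c5 *: x2 + c6 *: x1) + (c7 *: x5 + c8 *: x6))
  = ((d1 *: x1 + d2 *: x3) + (d3 *: x2 + d4 *: x5))
    + ((d5 *: x3 + d6 *: x1) + (d7 *: x4 + d8 *: x6)).
Proof.
move=> e16 e25 e3 e4 e7 e8.
rewrite (AC ((2*2)*(2*2)) ((1*6)*(2*5)*3*4*7*8)) [RHS](AC ((2*2)*(2*2))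
  ((1*6)*3*(2*5)*7*4*8)) /=.
by rewrite -!scalerDl e16 e25 e3 e4 e7 e8.
Qed.

Lemma basis_braid_ybe (t : V ⊗ (V ⊗ V)) :
  tfront V tau (ttail V tau (tfront V tau t)) = ttail V tau (tfront V tau (ttail V tau t)).
Proof.
have altau i j k : tfront V tau (b i ⊗ₜ (b j ⊗ₜ b k))
    = al1 i j *: (b i ⊗ₜ (b j ⊗ₜ b k)) + be1 i j *: (b j ⊗ₜ (b i ⊗ₜ b k)).
  by rewrite tfrontE tauE tensorDl !tensorZl linearD !linearZ /= !tassocE.
have raptau i j k : ttail V tau (b i ⊗ₜ (b j ⊗ₜ b k))
    = al1 j k *: (b i ⊗ₜ (b j ⊗ₜ b k)) + be1 j k *: (b i ⊗ₜ (b k ⊗ₜ b j)).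
  by rewrite ttailE tauE tensorDr !tensorZr.
move: t; tlin => v s; elim/(basis_ind hb): v => [|a x y IHx IHy|i].
- by rewrite tensor0l !linear0.
- by rewrite tensor_linearl !(linearD, linearZZ) IHx IHy.
elim/(basis_tens_ind hb): s => [|a x y IHx IHy|j k].
- by rewrite tensor0r !linear0.
- by rewrite tensor_linearr !(linearD, linearZZ) IHx IHy.
rewrite altau raptau; linD; linZ.
rewrite !altau !raptau; linD; linZ.
rewrite !altau !raptau !scalerDr !scalerA.
have [e1 e2 e3] := coef_ybe i j k.
by apply: ybe_terms => //; ring.
Qed.

Lemma ext_anticomm v w : ext_inc V v * ext_inc V w = - (ext_inc V w * ext_inc V v).
Proof.
have := ext_inc_sqr (v + w); rewrite linearD mulrDl !mulrDr !ext_inc_sqr.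
by rewrite add0r addr0 => /eqP; rewrite addr_eq0 => /eqP.
Qed.

(** Vectors anticommute in [E], so [tau] multiplies the product by [al1 i j - be1 i j], which is [p]
    off the diagonal; on the diagonal the product is zero. *)
Lemma basis_braid_mul v w :
  ext_mul V (tpair (ext_inc V) (ext_inc V) (tau (v ⊗ₜ w)))
    = p *: (ext_inc V v * ext_inc V w).
Proof.
have := @basis_tens_eq _ _ _ _ hb _ (ext_mul V \o tpair (ext_inc V) (ext_inc V) \o tau)
  (p \*: (ext_mul V \o tpair (ext_inc V) (ext_inc V))).
move=> /(_ _ (v ⊗ₜ w)) /=; rewrite tpairE ext_mulE; apply=> i j.
rewrite tpairE ext_mulE tauE !(linearD, linearZZ) !tpairE !ext_mulE (ext_anticomm (b j)).
rewrite scalerN -scalerBl /al1 /be1.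
case: eqVneq => [->|_]; first by rewrite ext_inc_sqr !scaler0.
by case: ifP => _; congr (_ *: _); ring.
Qed.

Lemma basis_braid_hecke t : tau (tau t) = (p - 1) *: tau t + p *: t.
Proof.
apply: (basis_tens_eq hb (f := tau \o tau) (g := ((p - 1) \*: tau) \+ (p \*: idfun))) => i j
  /=.
rewrite tauE; linD; linZ; rewrite !tauE !scalerDr !scalerA.
rewrite [LHS](AC (2*2) ((1*4)*(2*3))) [RHS](AC (2*1) ((1*3)*2)) /= -!scalerDl.
congr (_ *: _ + _ *: _); rewrite /al1 /be1;
  by have [] := ltgtP i j => _; ring.
Qed.

Lemma basis_braid_diag v : tau (v ⊗ₜ v) = - (v ⊗ₜ v).
Proof.
(* Polarization: the claim on [x ⊗ y + y ⊗ x] is bilinear, hence may be checked on the basis, and it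
   controls the cross terms of a square. *)
have sym x y : tau (x ⊗ₜ y + y ⊗ₜ x) = - (x ⊗ₜ y + y ⊗ₜ x).
  elim/(basis_ind hb): x => [|a x x' IHx IHx'|i].
  - by rewrite tensor0l tensor0r addr0 linear0 oppr0.
  - rewrite tensor_linearl tensor_linearr addrACA -scalerDr linearP /= IHx IHx'.
    by rewrite scalerN [RHS]opprD.
  elim/(basis_ind hb): y => [|a y y' IHx IHx'|j].
  - by rewrite tensor0l tensor0r addr0 linear0 oppr0.
  - rewrite tensor_linearl tensor_linearr addrACA -scalerDr linearP /= IHx IHx'.
    by rewrite scalerN [RHS]opprD.
  rewrite linearD !tauE [LHS](AC (2*2) ((1*4)*(2*3))) /= -!scalerDl -scaleN1r scalerDr.
  congr (_ *: _ + _ *: _); rewrite /al1 /be1;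
    by have [] := ltgtP i j => _; ring.
elim/(basis_ind hb): v => [|a x y IHx IHy|i].
- by rewrite tensor0l linear0 oppr0.
- rewrite tensor_linearl !tensor_linearr -[LHS]/(tau _).
  have -> : a *: (a *: (x ⊗ₜ x) + x ⊗ₜ y) + (a *: (y ⊗ₜ x) + y ⊗ₜ y)
      = a *: (a *: (x ⊗ₜ x)) + (a *: (x ⊗ₜ y + y ⊗ₜ x) + y ⊗ₜ y).
    by rewrite !scalerDr !addrA.
  rewrite linearD [tau (a *: (_ + _) + _)]linearD; linZ; rewrite sym IHx IHy.
  by rewrite !scalerN -!opprD.
by rewrite tauE /al1 /be1 eqxx scaleN1r scale0r addr0.
Qed.

Lemma basis_braid_split : {e : {linear V ⊗ V -> V ⊗ V} |
  forall t, lspan (fun x => exists v, x = v ⊗ₜ v) (t - e (t + tau t))}.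
Proof.
(* On [t + tau t], keeping the tensors with [i < j] returns [t] itself if [i < j], minus the swapped
   tensor if [i > j], and zero if [i = j]. What is left of [t] is zero, a symmetric sum or a
   square. *)
have [e eE] := basis_bilinear hb (fun i j => if (i < j)%O then b i ⊗ₜ b j else 0).
exists e => t; elim/(basis_tens_ind hb): t => [|a x y Px Py|i j].
- by rewrite !linear0 addr0 linear0 subr0; exact: lspan0.
- have -> : a *: x + y - e (a *: x + y + tau (a *: x + y))
      = a *: (x - e (x + tau x)) + (y - e (y + tau y)).
    linD; linZ; linD; linZ.
    by rewrite [a *: e x + e y + _]addrACA opprD addrACA -scalerDr -scalerBr.
  by apply: lspanD => //; apply: lspanZ.
rewrite tauE; linD; linZ; rewrite !eE /al1 /be1.
case: (ltgtP i j) => [ij|ij|<-].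
- by rewrite scale0r !scaler0 !addr0 subrr; exact: lspan0.
- rewrite add0r scaler0 add0r scaleN1r opprK.
  have -> : b i ⊗ₜ b j + b j ⊗ₜ b i
      = (b i + b j) ⊗ₜ (b i + b j) - b i ⊗ₜ b i - b j ⊗ₜ b j.
    rewrite tensorDl !tensorDr [b i ⊗ₜ b i + _]addrC addrACA.
    by rewrite -[RHS]addrA -opprD addrK.
  have sq v : lspan (fun x => exists v, x = v ⊗ₜ v) (v ⊗ₜ v).
    by apply: lspan_gen; exists v.
  by apply: lspanD; [apply: lspanD => //|]; apply/lspanN.
- by rewrite !scaler0 !addr0 subr0; apply: lspan_gen; exists (b i).
Qed.
End BasisBraiding.

(** * The braided Hopf algebra *)

Lemma tmap_ttail (F : fieldType) (X Y W : lmodType F) (A : {linear Y -> W}) (t : X ⊗ Y) :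
  tmap idfun A t = ttail X A t.
Proof. by move: t; tlin => x y; rewrite tmapE ttailE. Qed.

(** * From left-bracketed to right-bracketed operators *)

Section Rebracketing.
Variables (F : fieldType) (X Y U W M : lmodType F).

Lemma tmap_thead (A : {linear X ⊗ Y -> W}) (t : X ⊗ Y ⊗ M) :
  tmap A idfun t = thead M A (tassoc t).
Proof. by move: t; tlin => s m; move: s; tlin => x y; rewrite tmapE tassocE theadE. Qed.

Lemma tmap_tfront (A : {linear X ⊗ Y -> U ⊗ W}) (t : X ⊗ Y ⊗ M) :
  tmap A idfun t = tassocV (tfront M A (tassoc t)).
Proof.
move: t; tlin => s m.
move: s; tlin => x y.
by rewrite tmapE tassocE tfrontE tassocK.
Qed.

Lemma idtens_ttail (A : {linear X ⊗ Y -> U ⊗ W}) (t : M ⊗ X ⊗ Y) :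
  idtens A t = tassocV (ttail M A (tassoc t)).
Proof. by rewrite /idtens /= tmap_ttail. Qed.
End Rebracketing.

Lemma tfront_cancel (F : fieldType) (X Y M : lmodType F) (A B : {linear X ⊗ Y -> X ⊗ Y}) :
  cancel A B -> cancel (tfront M A) (tfront M B).
Proof.
move=> AK; tlin => x; tlin => y m; rewrite tfrontE.
have -> s : tfront M B (tassoc (s ⊗ₜ m)) = tassoc (B s ⊗ₜ m).
  by move: s; tlin => x' y'; rewrite tassocE tfrontE.
by rewrite AK tassocE.
Qed.

Lemma ttail_cancel (F : fieldType) (X M : lmodType F) (A B : {linear M -> M}) :
  cancel A B -> cancel (ttail X A) (ttail X B).
Proof. by move=> AK t; rewrite ttail_comp ttail_id. Qed.

Section Glue.
Variables (F : fieldType) (p : F) (V : lmodType F).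
Variables tau sigma : {linear V ⊗ V -> V ⊗ V}.
Hypotheses (tauP : exterior_braiding tau) (sigmaP : exterior_braiding sigma).
Hypothesis sigmaK : cancel sigma tau.
Hypothesis tauK : cancel tau sigma.
Hypothesis mul_tau : forall v w : V,
  ext_mul V (tpair (ext_inc V) (ext_inc V) (tau (v ⊗ₜ w)))
    = p *: (ext_inc V v * ext_inc V w).

Local Notation E := (ext V : lmodType F).
Local Notation mul := (@ext_mul F V).
Local Notation beta := (braid tauP).
Local Notation D := (comul tauP).
Local Notation DX := (comul_thead tauP).
Local Notation eps := (@counit F V).
Local Notation S := (@antipode F p V).
Local Notation mX := (thead _ (@ext_mul F V)).
Local Notation thr := (braid_through tauP).

Lemma ext_unit_exists : {u : {linear F^o -> E} | forall c, u c = c *: 1}.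
Proof.
have lin : linear (fun c : F^o => c *: (1 : E)).
  by move=> a c c'; rewrite scalerDl -scalerA.
pose uL := GRing.isLinear.Build F F^o E *:%R _ lin.
by exists (HB.pack (fun c : F^o => c *: (1 : E)) uL : {linear F^o -> E}).
Qed.
Definition ext_unit : {linear F^o -> E} := sval ext_unit_exists.
Lemma ext_unitE c : ext_unit c = c *: 1.
Proof. exact: (svalP ext_unit_exists). Qed.

Lemma mul_midtens q : mX (ttail E (thr mul) q)
  = tmap mul mul (tassocV (tmap idfun (tassoc \o tmap beta idfun \o tassocV) q)).
Proof.
move: q; tlin => a; tlin => b; tlin => c d.
rewrite ttailE tmapE /= tassocVE tmapE braid_throughE tfrontE.
move: (beta _); tlin => c' b'; rewrite tassocE tassocVE ttailE theadE tmapE.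
by rewrite !ext_mulE.
Qed.

(** [braid_mull] splits the product on the left and [braid_mulr], used twice, the one on the right;
    this produces the four braidings of the relation. *)
Lemma braid_fusion t : beta (tmap mul mul t)
  = tmap mul mul (midtens beta (tmap beta beta (midtens beta t))).
Proof.
have step a u : ttail E mul (tfront E beta (a ⊗ₜ mX (ttail E beta u)))
    = tmap mul mul (midtens beta (tmap beta beta (tassocV (a ⊗ₜ u)))).
  rewrite /midtens /=; move: u; tlin => c; tlin => b d.
  rewrite ttailE tassocVE tmapE; move: (beta (b ⊗ₜ d)); tlin => d' b'.
  rewrite theadE ext_mulE tfrontE.
  have -> : beta (a ⊗ₜ (c * d')) = mX (ttail E beta (tassoc (beta (a ⊗ₜ c) ⊗ₜ d'))).
    have := braid_mulr tauP (a ⊗ₜ (c ⊗ₜ d')).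
    by rewrite ttailE ext_mulE braid_throughE tfrontE.
  move: (beta (a ⊗ₜ c)); tlin => c' a'.
  rewrite !tassocE ttailE tmapE /= tassocVE tmapE.
  move: (beta (a' ⊗ₜ d')); tlin => d2 a2.
  by rewrite theadE !tassocE tassocVE ttailE tmapE !ext_mulE.
(* [midtens] is a bare function; its bundled copy [m] permits the reduction to pure tensors. *)
have [m mE] : {m : {linear (E ⊗ E) ⊗ (E ⊗ E) -> (E ⊗ E) ⊗ (E ⊗ E)} |
    forall u, midtens beta u = m u}.
  by exists (tassocV \o tmap idfun (tassoc \o tmap beta idfun \o tassocV) \o tassoc).
rewrite !mE; move: t; tlin => s1 s2; move: s1; tlin => a b; move: s2; tlin => c d.
rewrite -!mE tmapE !ext_mulE.
have -> : beta ((a * b) ⊗ₜ (c * d)) = thr mul (a ⊗ₜ beta (b ⊗ₜ (c * d))).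
  have := braid_mull tauP (a ⊗ₜ (b ⊗ₜ (c * d))).
  by rewrite theadE ext_mulE ttailE.
have -> : beta (b ⊗ₜ (c * d)) = mX (ttail E beta (tfront E beta (b ⊗ₜ (c ⊗ₜ d)))).
  have := braid_mulr tauP (b ⊗ₜ (c ⊗ₜ d)).
  by rewrite ttailE ext_mulE braid_throughE.
rewrite braid_throughE step; congr (tmap mul mul (midtens beta (tmap beta beta _))).
by rewrite /midtens /= tassocE tmapE /= tassocVE tmapE tfrontE.
Qed.

Lemma tau_is_braiding : is_braiding tau.
Proof.
split; first by exists sigma.
by move=> t; rewrite /= !tmap_tfront !idtens_ttail !tassocVK (tau_ybe tauP).
Qed.

Lemma tlunit_counitl (M : lmodType F) : tlunit \o tmap eps idfun =1 counitl V M.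
Proof. by apply: tens_eq => x m; rewrite /= tmapE tlunitE counitlE. Qed.

Lemma trunit_counitr (M : lmodType F) : trunit \o tmap idfun eps =1 counitr V M.
Proof. by apply: tens_eq => m x; rewrite /= tmapE trunitE counitrE. Qed.

Lemma tmap_tfst (M : lmodType F) (h : {linear E -> E}) t : tmap h idfun t = tfst M h t.
Proof. by move: t; tlin => x m; rewrite tmapE tfstE. Qed.

Lemma comul_thead_tmap (M : lmodType F) t : DX M t = tassoc (tmap D idfun t).
Proof. by move: t; tlin => x m; rewrite comul_theadE tmapE. Qed.

Lemma ext_braidedHopf : exists B : braidedHopf (ext V),
  [/\ forall x y : ext V, hmul B (x ⊗ₜ y) = x * y,
      forall c : F, hunit B c = c%:A,
      forall v : V, hcomul B (ext_incl v) = ext_incl v ⊗ₜ 1 + 1 ⊗ₜ ext_incl v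
    & induced_by B (@ext_incl F V) tau].
Proof.
unshelve eexists (@BraidedHopf F E beta mul ext_unit D eps S
  _ _ _ _ _ _ _ _ _ _ _ _ _ _ _ _ _ _ _ _).
- split; first by exists (braid sigmaP); apply: braidVK.
  by move=> t; rewrite /= !tmap_tfront !idtens_ttail !tassocVK braid_ybe.
- move=> t /=; move: t; tlin => s z; move: s; tlin => x y.
  by rewrite tassocE !tmapE !ext_mulE mulrA.
- by apply: tens_eq => c x; rewrite /= tmapE ext_mulE tlunitE ext_unitE -scalerAl mul1r.
- by apply: tens_eq => x c; rewrite /= tmapE ext_mulE trunitE ext_unitE -scalerAr mulr1.
- by move=> x; rewrite /= tmap_ttail -comul_coassoc comul_thead_tmap.
- by move=> x; rewrite -[RHS](comul_counitl tauP) -tlunit_counitl.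
- by move=> x; rewrite -[RHS](comul_counitr tauP) -trunit_counitr.
- move=> x; rewrite /= tmap_ttail ext_unitE.
  by rewrite (comul_antipoder tauP mul_tau).
- move=> x; rewrite /= ext_unitE -(comul_antipodel tauP mul_tau).
  by rewrite tmap_tfst.
- apply: tens_eq => x y /=.
  by rewrite ext_mulE tmapE comul_mul mul_midtens comul_theadE.
- by move=> c x; rewrite ext_unitE tensorZl tensorZr linearZZ braid1.
- by move=> c x; rewrite ext_unitE tensorZl tensorZr linearZZ braidr1.
- move=> t; rewrite [LHS]tlunit_counitl [RHS]trunit_counitr; exact: braid_counitl.
- move=> t; rewrite [LHS]trunit_counitr [RHS]tlunit_counitl; exact: braid_counitr.
- move=> t; rewrite /= tmap_thead braid_mull braid_throughE.
  by rewrite tmap_ttail tmap_tfront idtens_ttail !tassocVK.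
- move=> t; rewrite /= tmap_ttail braid_mulr braid_throughE.
  by rewrite tmap_thead tmap_tfront idtens_ttail !tassocVK.
- move=> t; rewrite /= tmap_ttail braid_comulr.
  by rewrite tmap_tfront idtens_ttail comul_thead_tmap !tassocVK.
- move=> t; rewrite /= -[LHS]tassocK -comul_thead_tmap braid_comull braid_throughE.
  by rewrite tmap_ttail tmap_tfront idtens_ttail !tassocVK.
- by move=> t; rewrite /= tmap_tfst tmap_ttail (braid_antipodel p tauP).
- by move=> t; rewrite /= tmap_tfst tmap_ttail (braid_antipoder p tauP).
split=> [x y|c|v|] /=.
- exact: ext_mulE.
- exact: ext_unitE.
- by rewrite -ext_incE comul_incl.
split=> [||t||] /=.
- exact: tau_is_braiding.
- split; first exact: ext_incl_inj.
  move=> P /= P1 Pi PZD PM; apply: ext_ind_l => [||v x Px].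
  + by rewrite -[1]scale1r -ext_unitE.
  + exact: PZD.
  + by rewrite -ext_mulE ext_incE; apply: PM.
- have inc2 u : tmap (@ext_incl F V) (@ext_incl F V) u = tpair (ext_inc V) (ext_inc V) u.
    by move: u; tlin => v w; rewrite tmapE tpairE !ext_incE.
  by rewrite !inc2 braid_incl.
- split=> c x; rewrite ext_unitE tensorZl tensorZr linearZZ.
    by rewrite braid1.
  by rewrite braidr1.
- exact: braid_fusion.
Qed.
End Glue.

Theorem theorem1 (F : fieldType) (p : F) (hp : p != 0) (V : lmodType F)
    (d : Order.disp_t) (I : orderType d) (b : I -> V) (hb : is_basis b)
    (tau : {linear V ⊗ V -> V ⊗ V})
    (htau : forall i j : I, tau (b i ⊗ₜ b j) =
       if i == j then - (b i ⊗ₜ b i)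
       else if (j < i)%O then - ((1 - p) *: (b i ⊗ₜ b j)) - b j ⊗ₜ b i
       else - (p *: (b j ⊗ₜ b i))) :
  exists B : braidedHopf (ext V),
    [/\ forall x y : ext V, hmul B (x ⊗ₜ y) = x * y,
        forall c : F, hunit B c = c%:A,
        forall v : V, hcomul B (ext_incl v) = ext_incl v ⊗ₜ 1 + 1 ⊗ₜ ext_incl v
      & induced_by B (@ext_incl F V) tau].
Proof.
have ybe := basis_braid_ybe hb htau.
have diag := basis_braid_diag hb htau.
have [e eP] := basis_braid_split hb htau.
pose tauP := ExteriorBraiding ybe diag eP.
have hecke := basis_braid_hecke hb htau.
(* The Hecke relation solved for the inverse of [tau], using [p != 0]. *)
have [sigma sigmaE] : {s : {linear V ⊗ V -> V ⊗ V} |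
    forall t, s t = p^-1 *: (tau t + (1 - p) *: t)}.
  by exists (p^-1 \*: (tau \+ ((1 - p) \*: idfun))).
have cancelp (t : V ⊗ V) : p^-1 *: (((p - 1) *: tau t + p *: t) + (1 - p) *: tau t) = t.
  by rewrite addrAC -scalerDl -opprB addNr scale0r add0r scalerA mulVf // scale1r.
have tauK : cancel tau sigma by move=> t; rewrite sigmaE hecke.
have sigmaK : cancel sigma tau.
  by move=> t; rewrite sigmaE linearZZ linearD linearZZ hecke.
have sigma_diag v : sigma (v ⊗ₜ v) = - (v ⊗ₜ v).
  by rewrite -{1}[v ⊗ₜ v]opprK -diag linearN tauK.
(* Since [tau (t + sigma t) = tau t + t], the splitting [e] of [tau] precomposed with [tau] is a
   splitting for [sigma]. *)
have fP t : lspan (fun x => exists v, x = v ⊗ₜ v) (t - (e \o tau) (t + sigma t)).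
  by rewrite /= linearD sigmaK addrC [tau t + t]addrC addrC; exact: eP.
have sigma_ybe (t : V ⊗ (V ⊗ V)) : tfront V sigma (ttail V sigma (tfront V sigma t))
    = ttail V sigma (tfront V sigma (ttail V sigma t)).
  have alK : cancel (tfront V sigma) (tfront V tau) := tfront_cancel sigmaK.
  have rapK : cancel (ttail V sigma) (ttail V tau) := ttail_cancel sigmaK.
  have alVK : cancel (tfront V tau) (tfront V sigma) := tfront_cancel tauK.
  have rapVK : cancel (ttail V tau) (ttail V sigma) := ttail_cancel tauK.
  (* Three applications of [tau] bring [w] back to [t]; by the Yang-Baxter equation for [tau] they
     may be taken in the other order, and undoing that order gives the right-hand side. *)
  set w := LHS; have tw : ttail V tau (tfront V tau (ttail V tau w)) = t.
    by rewrite -ybe /w alK rapK alK.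
  by rewrite -[in RHS]tw rapVK alVK rapVK.
pose sigmaP := ExteriorBraiding sigma_ybe sigma_diag fP.
exact: (ext_braidedHopf tauP sigmaP sigmaK tauK
  (basis_braid_mul hb htau)).
Qed.
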